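(* Let $n\ge1$. Then $\{K^\lambda\mid\lambda\vdash n\}$ is a complete list of pairwise inequivalent simple modules of the Hecke-Clifford superalgebra $\mathfrak{H}^{\mathfrak c}_{B_n}=\mathcal{C}l_n\rtimes B_n$, all of type $\mathtt{M}$.
   Context: All algebras and modules are finite-dimensional over $\mathbb{C}$. Modules over a superalgebra $A$ are $\mathbb{Z}_2$-graded, simple means no proper nonzero graded submodule, $\mathrm{Hom}_A(M,N)$ is spanned by all homogeneous (even and odd) linear maps $f$ with $f(am)=(-1)^{|f||a|}af(m)$; isomorphisms may be even or odd. A simple $M$ is of type $\mathtt{M}$ if $\dim\mathrm{Hom}_A(M,M)=1$ and of type $\mathtt{Q}$ if this dimension is $2$. $B_n=\mathbb{Z}_2^n\rtimes S_n$ is the group of signed permutations. $\mathcal{C}l_n$ is the Clifford superalgebra with odd generators $c_1,\dots,c_n$, $c_i^2=1$, $c_ic_j=-c_jc_i$ ($i\ne j$), on which $B_n$ acts by algebra automorphisms through signed permutations of the $c_i$. $\mathfrak{H}^{\mathfrak c}_{B_n}=\mathcal{C}l_n\rtimes B_n$ is the semidirect (smash) product, with elements of $B_n$ even. $K^\lambda=\mathcal{C}l_n\otimes S^\lambda$, where $S^\lambda$ is the Specht module of $S_n$ regarded as a (purely even) $B_n$-module through the projection $B_n\to S_n$; $\mathcal{C}l_n$ acts by left multiplication on the first factor and $B_n$ acts diagonally. *)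

(* Defs.v *)
From HB Require Import structures.
From mathcomp Require Import all_boot all_order all_fingroup all_algebra all_field.
From mathcomp Require Import complex boolp reals.

Set Implicit Arguments.
Unset Strict Implicit.
Unset Printing Implicit Defensive.

Import GRing.Theory.
Local Open Scope ring_scope.

Section LinearAlgebra.
Variable F : fieldType.

Lemma linfun_linE (U V : vectType F) (f : U -> V) (x : U) :
  linear f -> linfun f x = f x.
Proof.
move=> lf; pose g : {linear U -> V} :=
  HB.pack_for {linear U -> V} f (GRing.isLinear.Build F U V *:%R f lf).
exact: (lfunE g x).
Qed.

Definition is_span (V : vectType F) (P : V -> Prop) (U : {vspace V}) : Prop :=
  (forall v, P v -> v \in U) /\
  (forall W : {vspace V}, (forall v, P v -> v \in W) -> (U <= W)%VS).

Lemma is_span_exists (V : vectType F) (P : V -> Prop) : exists U, is_span P U.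
Proof.
pose good (d : nat) := `[< exists2 U : {vspace V},
  forall v, P v -> v \in U & \dim U = d >].
have exg : exists d, good d.
  by exists (\dim {: V}); apply/asboolP; exists fullv => // v _; exact: memvf.
have [d /asboolP[U PU dU] dmin] := ex_minnP exg.
exists U; split=> // W PW.
have: (\dim U <= \dim (U :&: W))%N.
  rewrite dU; apply: dmin; apply/asboolP; exists (U :&: W)%VS => // v Pv.
  by rewrite memv_cap PU ?PW.
move=> le; have /eqP <- : (U :&: W)%VS == U by rewrite eqEdim capvSl.
exact: capvSr.
Qed.

Definition vspan (V : vectType F) (P : V -> Prop) : {vspace V} :=
  sval (cid (is_span_exists P)).

Lemma vspanP (V : vectType F) (P : V -> Prop) : is_span P (vspan P).
Proof. exact: (svalP (cid (is_span_exists P))). Qed.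

(* The even part is [P false], the odd part is [P true]. *)
Definition is_Z2grading (V : vectType F) (P : bool -> {vspace V}) : Prop :=
  (P false :&: P true = 0)%VS /\ (P false + P true = fullv)%VS.

Record superalgebra := Superalgebra {
  sa_sort :> falgType F;
  sa_part : bool -> {vspace sa_sort};
  sa_grading : is_Z2grading sa_part;
  sa_part1 : 1 \in sa_part false;
  sa_partM : forall i j a b,
    a \in sa_part i -> b \in sa_part j -> a * b \in sa_part (i (+) j)
}.

Record smodule (A : superalgebra) := SModule {
  sm_sort :> vectType F;
  sm_part : bool -> {vspace sm_sort};
  sm_act : A -> 'End(sm_sort);
  sm_grading : is_Z2grading sm_part;
  sm_act_linear : linear sm_act;
  sm_act1 : forall m, sm_act 1 m = m;
  sm_actM : forall a b m, sm_act (a * b) m = sm_act a (sm_act b m);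
  sm_act_part : forall i j a m,
    a \in sa_part A i -> m \in sm_part j -> sm_act a m \in sm_part (i (+) j)
}.

Definition graded_submod (A : superalgebra) (M : smodule A) (U : {vspace M}) : Prop :=
  U = (U :&: sm_part M false + U :&: sm_part M true)%VS /\
  (forall a u, u \in U -> sm_act M a u \in U).

Definition simple_smod (A : superalgebra) (M : smodule A) : Prop :=
  (fullv : {vspace M}) <> 0%VS /\
  (forall U : {vspace M}, graded_submod U -> U = 0%VS \/ U = fullv).

(* Homogeneous homomorphisms of parity [p]; [p && j] is the product of the
   parities modulo 2. *)
Definition homog_hom (A : superalgebra) (M N : smodule A) (p : bool)
    (f : 'Hom(M, N)) : Prop :=
  (forall i m, m \in sm_part M i -> f m \in sm_part N (i (+) p)) /\
  (forall j a m, a \in sa_part A j ->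
     f (sm_act M a m) = (-1) ^+ (p && j) *: sm_act N a (f m)).

Definition Hom_smod (A : superalgebra) (M N : smodule A) : {vspace 'Hom(M, N)} :=
  vspan (fun f : 'Hom(M, N) => exists p, homog_hom p f).

Definition typeM (A : superalgebra) (M : smodule A) : Prop :=
  \dim (Hom_smod M M) = 1%N.

Definition smod_iso (A : superalgebra) (M N : smodule A) : Prop :=
  exists (p : bool) (f : 'Hom(M, N)), homog_hom p f /\ bijective f.

Record superaction (gT : finGroupType) (A : superalgebra) := SuperAction {
  ga_act :> gT -> 'End(A);
  ga_act1 : forall a, ga_act 1%g a = a;
  ga_actM : forall g h a, ga_act (g * h)%g a = ga_act g (ga_act h a);
  ga_one : forall g, ga_act g 1 = 1;
  ga_mul : forall g a b, ga_act g (a * b) = ga_act g a * ga_act g b;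
  ga_part : forall g i a, a \in sa_part A i -> ga_act g a \in sa_part A i
}.

Record lrep (gT : finGroupType) := LRep {
  lr_sort :> vectType F;
  lr_act : gT -> 'End(lr_sort);
  lr_act1 : forall v, lr_act 1%g v = v;
  lr_actM : forall g h v, lr_act (g * h)%g v = lr_act g (lr_act h v)
}.

Definition ffun_ev (I : finType) (V : vectType F) (i : I) :
  'Hom({ffun I -> V}, V) := linfun (fun k : {ffun I -> V} => k i).

Lemma ffun_evE (I : finType) (V : vectType F) (i : I) (k : {ffun I -> V}) :
  ffun_ev V i k = k i.
Proof. by rewrite /ffun_ev linfun_linE // => a u v; rewrite !ffunE. Qed.

Lemma memv_bigcapP (V : vectType F) (I : finType) (P : pred I)
    (U : I -> {vspace V}) (v : V) :
  reflect (forall i, P i -> v \in U i) (v \in (\bigcap_(i | P i) U i)%VS).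
Proof. by rewrite memvE; apply: (iffP subv_bigcapP) => H i /H; rewrite memvE. Qed.

End LinearAlgebra.

(* [x : smash act] is the element [\sum_g (x g) g] of A x| G; the product is
   determined by [g a = (act g a) g]. *)
Definition smash (F : fieldType) (gT : finGroupType) (A : superalgebra F)
  (act : superaction gT A) : Type := {ffun gT -> A}.

Section Smash.
Variables (F : fieldType) (gT : finGroupType) (A : superalgebra F).
Variable act : superaction gT A.

HB.instance Definition _ := Vector.copy (smash act) {ffun gT -> A}.

Implicit Types x y z : smash act.

Definition smash_elt (a : A) (g : gT) : smash act :=
  [ffun h => if h == g then a else 0].

Definition smash_one : smash act := smash_elt 1 1%g.

Definition smash_mul x y : smash act :=
  [ffun k => \sum_g x g * act g (y (g^-1 * k)%g)].

Lemma smash_mulA : associative smash_mul.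
Proof.
move=> x y z; apply/ffunP => k; rewrite !ffunE.
under [RHS]eq_bigr => h _ do rewrite ffunE mulr_suml.
rewrite exchange_big; apply: eq_bigr => g _ /=.
rewrite ffunE linear_sum mulr_sumr (reindex_inj (mulgI g^-1%g)) /=.
apply: eq_bigr => h _.
by rewrite ga_mul -ga_actM mulrA mulKVg invMg invgK -mulgA mulKVg.
Qed.

Lemma smash_mul1l : left_id smash_one smash_mul.
Proof.
move=> x; apply/ffunP => k; rewrite ffunE (bigD1 1%g) //= big1 ?addr0 => [|g].
  by rewrite ffunE eqxx mul1r ga_act1 invg1 mul1g.
by move=> /negPf g1; rewrite ffunE g1 mul0r.
Qed.

Lemma smash_mul1r : right_id smash_one smash_mul.
Proof.
move=> x; apply/ffunP => k; rewrite ffunE (bigD1 k) //= big1 ?addr0 => [|g].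
  by rewrite ffunE mulVg eqxx ga_one mulr1.
by move=> /negPf gk; rewrite ffunE -eq_mulVg1 gk linear0 mulr0.
Qed.

Lemma smash_mulDl : left_distributive smash_mul +%R.
Proof.
move=> x y z; apply/ffunP => k; rewrite !ffunE -big_split.
by apply: eq_bigr => g _; rewrite ffunE mulrDl.
Qed.

Lemma smash_mulDr : right_distributive smash_mul +%R.
Proof.
move=> x y z; apply/ffunP => k; rewrite !ffunE -big_split.
by apply: eq_bigr => g _; rewrite ffunE linearD mulrDr.
Qed.

Lemma smash_one_neq0 : smash_one != 0.
Proof.
by apply/eqP => /ffunP/(_ 1%g); rewrite !ffunE eqxx => /eqP; rewrite oner_eq0.
Qed.

HB.instance Definition _ := GRing.Zmodule_isNzRing.Build (smash act)
  smash_mulA smash_mul1l smash_mul1r smash_mulDl smash_mulDr smash_one_neq0.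

Lemma smash_mulE x y : x * y = smash_mul x y. Proof. by []. Qed.

Lemma smash_scalerAl (c : F) x y : c *: (x * y) = (c *: x) * y.
Proof.
apply/ffunP => k; rewrite !ffunE scaler_sumr.
by apply: eq_bigr => g _; rewrite ffunE scalerAl.
Qed.

HB.instance Definition _ :=
  GRing.Lmodule_isLalgebra.Build F (smash act) smash_scalerAl.

Lemma smash_scalerAr (c : F) x y : c *: (x * y) = x * (c *: y).
Proof.
apply/ffunP => k; rewrite !ffunE scaler_sumr.
by apply: eq_bigr => g _; rewrite ffunE linearZ scalerAr.
Qed.

HB.instance Definition _ :=
  GRing.Lalgebra_isAlgebra.Build F (smash act) smash_scalerAr.

HB.instance Definition _ := Algebra_isFalgebra.Build F (smash act).

Lemma smash_eltM a g b h :
  smash_elt a g * smash_elt b h = smash_elt (a * act g b) (g * h)%g.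
Proof.
apply/ffunP => k; rewrite !ffunE (bigD1 g) //= big1 ?addr0 => [|g' /negPf g'g].
  rewrite !ffunE eqxx (can2_eq (mulKVg _) (mulKg _)).
  by case: ifP; rewrite ?linear0 ?mulr0.
by rewrite ffunE g'g mul0r.
Qed.

(* The elements of the group are even. *)
Definition smash_part (i : bool) : {vspace smash act} :=
  (\bigcap_(g : gT) (ffun_ev A g @^-1: sa_part A i))%VS.

Lemma smash_partP i x :
  reflect (forall g, x g \in sa_part A i) (x \in smash_part i).
Proof.
apply: (iffP (memv_bigcapP _ _ _)) => H g.
  by have := H g isT; rewrite -memv_preim ffun_evE.
by move=> _; rewrite -memv_preim ffun_evE.
Qed.

Lemma smash_grading : is_Z2grading smash_part.
Proof.
have [A0 A1] := sa_grading A; split.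
  apply/eqP; rewrite -subv0; apply/subvP => x; rewrite memv_cap memv0.
  case/andP => /smash_partP x0 /smash_partP x1; apply/eqP/ffunP => g.
  by rewrite ffunE; apply/eqP; rewrite -memv0 -A0 memv_cap x0 x1.
apply/eqP; rewrite eqEsubv subvf /=; apply/subvP => x _.
pose p0 : smash act :=
  [ffun g => addv_pi1 (sa_part A false) (sa_part A true) (x g)].
pose p1 : smash act :=
  [ffun g => addv_pi2 (sa_part A false) (sa_part A true) (x g)].
have ->: x = p0 + p1.
  by apply/ffunP => g; rewrite !ffunE addv_pi1_pi2 // A1 memvf.
have P0 : p0 \in smash_part false.
  by apply/smash_partP => g; rewrite ffunE; exact: memv_pi1.
have P1 : p1 \in smash_part true.
  by apply/smash_partP => g; rewrite ffunE; exact: memv_pi2.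
exact: memv_add P0 P1.
Qed.

Lemma smash_part1 : 1 \in smash_part false.
Proof.
by apply/smash_partP => g; rewrite ffunE; case: ifP; rewrite ?mem0v ?sa_part1.
Qed.

Lemma smash_partM i j x y :
  x \in smash_part i -> y \in smash_part j -> x * y \in smash_part (i (+) j).
Proof.
move=> /smash_partP xi /smash_partP yj; apply/smash_partP => g; rewrite ffunE.
by apply: memv_suml => h _; apply: sa_partM => //; apply: ga_part.
Qed.

Definition smash_superalgebra : superalgebra F :=
  Superalgebra smash_grading smash_part1 smash_partM.

End Smash.

Section Symdiff.
Variable n : nat.
Implicit Types I J K : {set 'I_n}.

Definition symdiff I J : {set 'I_n} := (I :\: J) :|: (J :\: I).

Lemma in_symdiff I J i : (i \in symdiff I J) = (i \in I) (+) (i \in J).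
Proof. by rewrite !inE; do 2 case: (i \in _). Qed.

Lemma symdiffA : associative symdiff.
Proof. by move=> I J K; apply/setP => i; rewrite !in_symdiff addbA. Qed.

Lemma symdiff0l : left_id set0 symdiff.
Proof. by move=> I; apply/setP => i; rewrite in_symdiff inE. Qed.

Lemma symdiff0r : right_id set0 symdiff.
Proof. by move=> I; apply/setP => i; rewrite in_symdiff inE addbF. Qed.

Lemma odd_sumn (T : Type) (r : seq T) (P : pred T) (f : T -> nat) :
  odd (\sum_(i <- r | P i) f i)%N = \big[addb/false]_(i <- r | P i) odd (f i).
Proof. exact: (big_morph odd oddD). Qed.

Lemma odd_card_big (T : finType) (P : pred T) :
  odd #|[set x | P x]| = \big[addb/false]_x P x.
Proof.
rewrite cardsE -sum1_card odd_sumn [RHS]big_mkcond /= [LHS]big_mkcond /=.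
by apply: eq_bigr => x _; rewrite unfold_in; case: (P x).
Qed.

Lemma odd_symdiff I J : odd #|symdiff I J| = odd #|I| (+) odd #|J|.
Proof.
have oddE K : odd #|K| = \big[addb/false]_i (i \in K).
  by rewrite -odd_card_big; congr (odd #|pred_of_set _|); apply/setP => i; rewrite inE.
by rewrite !oddE -big_split; apply: eq_bigr => i _; rewrite in_symdiff.
Qed.

(* The pairs (i, j) in I x J with j < i, i.e. the transpositions needed to
   sort the monomial c_I c_J. *)
Definition inversions I J : {set 'I_n * 'I_n} :=
  [set p | [&& p.1 \in I, p.2 \in J & (p.2 < p.1)%N]].

Lemma odd_inversions I J : odd #|inversions I J| =
  \big[addb/false]_(p : 'I_n * 'I_n) [&& p.1 \in I, p.2 \in J & (p.2 < p.1)%N].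
Proof. exact: odd_card_big. Qed.

Lemma inversionsDl I J K : odd #|inversions (symdiff I J) K| =
  odd #|inversions I K| (+) odd #|inversions J K|.
Proof.
rewrite !odd_inversions -big_split; apply: eq_bigr => p _ /=.
by rewrite in_symdiff andb_addl.
Qed.

Lemma inversionsDr I J K : odd #|inversions I (symdiff J K)| =
  odd #|inversions I J| (+) odd #|inversions I K|.
Proof.
rewrite !odd_inversions -big_split; apply: eq_bigr => p _ /=.
by rewrite in_symdiff andb_addl andb_addr.
Qed.

Lemma inversions0l J : inversions set0 J = set0.
Proof. by apply/setP => p; rewrite !inE. Qed.

Lemma inversions0r I : inversions I set0 = set0.
Proof. by apply/setP => p; rewrite !inE andbF. Qed.

End Symdiff.

(* [a : clifford F n] is the element [\sum_I (a I) c_I], where c_I is the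
   product of the generators c_i, i \in I, taken in increasing order. *)
Definition clifford (F : fieldType) (n : nat) : Type := {ffun {set 'I_n} -> F^o}.

Section Clifford.
Variables (F : fieldType) (n : nat).

HB.instance Definition _ := Vector.copy (clifford F n) {ffun {set 'I_n} -> F^o}.

Implicit Types (i j : 'I_n) (I J K : {set 'I_n}) (a b c : clifford F n).

Definition cbasis I : clifford F n := [ffun J => (J == I)%:R].

Definition csign I J : F := (-1) ^+ #|inversions I J|.

Definition cmul a b : clifford F n :=
  \sum_I \sum_J (a I * b J * csign I J) *: cbasis (symdiff I J).

Lemma clifford_expand a : a = \sum_I a I *: cbasis I.
Proof.
apply/ffunP => J; rewrite sum_ffunE (bigD1 J) //= big1 ?addr0 => [|I /negPf IJ].
  by rewrite !ffunE eqxx [_ *: _]mulr1.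
by rewrite !ffunE eq_sym IJ [_ *: _]mulr0.
Qed.

Lemma cmul_linearl b : linear (cmul^~ b).
Proof.
move=> k a a'; rewrite /cmul scaler_sumr -big_split; apply: eq_bigr => I _ /=.
rewrite scaler_sumr -big_split; apply: eq_bigr => J _ /=.
by rewrite !ffunE scalerA -scalerDl !mulrDl !mulrA.
Qed.

Lemma cmul_linearr a : linear (cmul a).
Proof.
move=> k b b'; rewrite /cmul scaler_sumr -big_split; apply: eq_bigr => I _ /=.
rewrite scaler_sumr -big_split; apply: eq_bigr => J _ /=.
by rewrite !ffunE scalerA -scalerDl mulrDr mulrDl !mulrA (mulrC (a I) k).
Qed.

Lemma cmulDl : left_distributive cmul +%R.
Proof. by move=> a b c; have := cmul_linearl c 1 a b; rewrite !scale1r. Qed.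

Lemma cmulDr : right_distributive cmul +%R.
Proof. by move=> a b c; have := cmul_linearr a 1 b c; rewrite !scale1r. Qed.

Lemma cmulZl k a b : cmul (k *: a) b = k *: cmul a b.
Proof. exact: (GRing.scalable_linear (cmul_linearl b)). Qed.

Lemma cmulZr k a b : cmul a (k *: b) = k *: cmul a b.
Proof. exact: (GRing.scalable_linear (cmul_linearr a)). Qed.

Lemma cmul_basis I J :
  cmul (cbasis I) (cbasis J) = csign I J *: cbasis (symdiff I J).
Proof.
rewrite /cmul (bigD1 I) //= [X in _ + X]big1 ?addr0 => [|I' /negPf nI].
  rewrite (bigD1 J) //= big1 ?addr0 => [|J' /negPf nJ].
    by rewrite !ffunE !eqxx !mul1r.
  by rewrite !ffunE nJ mulr0 mul0r scale0r.
by apply: big1 => J' _; rewrite !ffunE nI !mul0r scale0r.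
Qed.

Lemma clifford_lin_ext (V : vectType F) (f g : clifford F n -> V) :
  linear f -> linear g -> (forall I, f (cbasis I) = g (cbasis I)) -> f =1 g.
Proof.
move=> lf lg fg a; rewrite -(linfun_linE a lf) -(linfun_linE a lg).
rewrite (clifford_expand a) !linear_sum; apply: eq_bigr => I _.
by rewrite !linearZ /= !linfun_linE // fg.
Qed.

Lemma csignDl I J K : csign (symdiff I J) K = csign I K * csign J K.
Proof.
by rewrite /csign -[LHS]signr_odd inversionsDl signr_addb !signr_odd.
Qed.

Lemma csignDr I J K : csign I (symdiff J K) = csign I J * csign I K.
Proof.
by rewrite /csign -[LHS]signr_odd inversionsDr signr_addb !signr_odd.
Qed.

Lemma cmulA : associative cmul.
Proof.
move=> a b c.
apply: (clifford_lin_ext (f := fun a => cmul a (cmul b c))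
                         (g := fun a => cmul (cmul a b) c)).
- exact: cmul_linearl.
- by move=> k x y; rewrite !cmul_linearl.
move=> I {a}.
apply: (clifford_lin_ext (f := fun b => cmul (cbasis I) (cmul b c))
                         (g := fun b => cmul (cmul (cbasis I) b) c)).
- by move=> k x y; rewrite cmul_linearl cmul_linearr.
- by move=> k x y; rewrite cmul_linearr cmul_linearl.
move=> J {b}.
apply: (clifford_lin_ext (f := fun c => cmul (cbasis I) (cmul (cbasis J) c))
                         (g := cmul (cmul (cbasis I) (cbasis J)))).
- by move=> k x y; rewrite !cmul_linearr.
- exact: cmul_linearr.
move=> K {c}; rewrite !cmul_basis.
rewrite cmulZl cmulZr !cmul_basis.
by rewrite !scalerA symdiffA csignDl csignDr; congr (_ *: _); rewrite mulrC -mulrA.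
Qed.

Lemma csign0l J : csign set0 J = 1.
Proof. by rewrite /csign inversions0l cards0. Qed.

Lemma csign0r I : csign I set0 = 1.
Proof. by rewrite /csign inversions0r cards0. Qed.

Lemma cmul1l : left_id (cbasis set0) cmul.
Proof.
move=> a; apply: (clifford_lin_ext (f := cmul (cbasis set0)) (g := id)) => //.
  exact: cmul_linearr.
by move=> I; rewrite cmul_basis csign0l scale1r symdiff0l.
Qed.

Lemma cmul1r : right_id (cbasis set0) cmul.
Proof.
move=> a; apply: (clifford_lin_ext (f := cmul^~ (cbasis set0)) (g := id)) => //.
  exact: cmul_linearl.
by move=> I; rewrite cmul_basis csign0r scale1r symdiff0r.
Qed.

Lemma cone_neq0 : cbasis set0 != 0.
Proof.
by apply/eqP => /ffunP/(_ set0); rewrite !ffunE eqxx => /eqP; rewrite oner_eq0.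
Qed.

HB.instance Definition _ := GRing.Zmodule_isNzRing.Build (clifford F n)
  cmulA cmul1l cmul1r cmulDl cmulDr cone_neq0.

Lemma cscalerAl (k : F) a b : k *: (a * b) = (k *: a) * b.
Proof. by rewrite [RHS]cmulZl. Qed.

HB.instance Definition _ :=
  GRing.Lmodule_isLalgebra.Build F (clifford F n) cscalerAl.

Lemma cscalerAr (k : F) a b : k *: (a * b) = a * (k *: b).
Proof. by rewrite [RHS]cmulZr. Qed.

HB.instance Definition _ :=
  GRing.Lalgebra_isAlgebra.Build F (clifford F n) cscalerAr.

HB.instance Definition _ := Algebra_isFalgebra.Build F (clifford F n).

Lemma cbasisM I J : cbasis I * cbasis J = csign I J *: cbasis (symdiff I J).
Proof. exact: cmul_basis. Qed.

Definition cgen (i : 'I_n) : clifford F n := cbasis [set i].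

Lemma inversions_set1r I j :
  inversions I [set j] = [set (i, j) | i in [set i in I | (j < i)%N]].
Proof.
apply/setP => -[i k]; rewrite !inE /=; apply/and3P/imsetP => [[iI /eqP-> ji]|].
  by exists i => //; rewrite inE iI.
by case=> i'; rewrite inE => /andP[? ?] [-> ->].
Qed.

Lemma card_inversions_set1r I j :
  #|inversions I [set j]| = count (fun i => (i \in I) && (j < i)%N) (index_enum 'I_n).
Proof.
rewrite inversions_set1r card_imset => [|i i' [] //].
by rewrite -sum1_card -sum1_count; apply: eq_bigl => i; rewrite inE.
Qed.

Section Monomials.
Variable x : 'I_n -> clifford F n.
Hypothesis x_sqr : forall i, x i * x i = 1.
Hypothesis x_anti : forall i j, i != j -> x i * x j = - (x j * x i).

Definition cmono I := \prod_(i in I) x i.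

Lemma cmono_seqC (s : seq 'I_n) I j : j \notin s ->
  (\prod_(i <- s | i \in I) x i) * x j =
  (-1) ^+ (count (mem I) s) *: (x j * \prod_(i <- s | i \in I) x i).
Proof.
elim: s => [|i s IH] /=; first by rewrite !big_nil mul1r mulr1 scale1r.
rewrite inE negb_or => /andP[ji js]; rewrite !big_cons /=.
case: ifP => iI; rewrite ?IH // -mulrA IH // -scalerAr !mulrA (x_anti ji).
by rewrite mulNr scalerN add1n exprS mulN1r scaleNr opprK.
Qed.

Lemma cmono_seqM (s : seq 'I_n) I j :
  sorted (fun i k : 'I_n => (i < k)%N) s -> j \in s ->
  (\prod_(i <- s | i \in I) x i) * x j =
  (-1) ^+ (count (fun i => (i \in I) && (j < i)%N) s) *:
    \prod_(i <- s | i \in symdiff I [set j]) x i.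
Proof.
have lt_trans : transitive (fun i k : 'I_n => (i < k)%N).
  by move=> ? ? ?; exact: ltn_trans.
elim: s => [//|i s IH] /=; rewrite (path_sortedE lt_trans) => /andP[/allP lt_is srt].
rewrite inE !big_cons in_symdiff in_set1 /=; case: (eqVneq j i) => [->{IH j} _|ji /= js].
  have is' : i \notin s by apply/negP => /lt_is; rewrite ltnn.
  have -> : count (fun k => (k \in I) && (i < k)%N) s = count (mem I) s.
    by apply: eq_in_count => k /lt_is ->; rewrite andbT.
  have -> : \prod_(k <- s | k \in symdiff I [set i]) x k = \prod_(k <- s | k \in I) x k.
    rewrite big_seq_cond [RHS]big_seq_cond; apply: eq_bigl => k.
    rewrite in_symdiff in_set1; case ks: (k \in s) => //=.
    by have /negPf -> : k != i; [apply: contraNneq is' => <-|rewrite addbF].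
  rewrite ltnn andbF add0n addbT; case: ifP => /= _.
    by rewrite -mulrA cmono_seqC // -scalerAr mulrA x_sqr mul1r.
  by rewrite cmono_seqC.
have lij := lt_is _ js; rewrite addbF ltnNge (ltnW lij) andbF add0n.
by case: ifP => _; rewrite -?mulrA IH // scalerAr.
Qed.

Lemma cmonoMx I j :
  cmono I * x j = (-1) ^+ #|inversions I [set j]| *: cmono (symdiff I [set j]).
Proof.
rewrite card_inversions_set1r; apply: cmono_seqM; last exact: mem_index_enum.
have : sorted ltn [seq val i | i <- enum 'I_n] by rewrite val_enum_ord iota_ltn_sorted.
by rewrite sorted_map enumT.
Qed.

Lemma inversions_lt0 I j : (forall i, i \in I -> (i < j)%N) ->
  inversions I [set j] = set0.
Proof.
move=> ltj; apply/setP => -[i k]; rewrite !inE /=; apply/and3P => -[/ltj ij /eqP->].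
by rewrite ltnNge (ltnW ij).
Qed.

Lemma cmonoS I j : (forall i, i \in I -> (i < j)%N) ->
  cmono (symdiff I [set j]) = cmono I * x j.
Proof. by move=> ltj; rewrite cmonoMx inversions_lt0 // cards0 scale1r. Qed.

Lemma cmono0 : cmono set0 = 1.
Proof. by rewrite /cmono big_set0. Qed.

End Monomials.

Lemma set_max_ind (P : {set 'I_n} -> Prop) : P set0 ->
  (forall I j, (forall i, i \in I -> (i < j)%N) -> P I -> P (symdiff I [set j])) ->
  forall I, P I.
Proof.
move=> P0 PS I; elim: {I}#|I| {-2}I (erefl #|I|) => [|m IH] I.
  by move=> /eqP; rewrite cards_eq0 => /eqP ->.
move=> cI; have [i0 i0I] : exists i, i \in I by apply/card_gt0P; rewrite cI.
case: (arg_maxnP (fun i : 'I_n => (i : nat)) i0I) => j jI jmax.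
have {}jI : j \in I := jI.
have -> : I = symdiff (I :\ j) [set j].
  by apply/setP => i; rewrite in_symdiff !inE; case: eqP => [->|_]; rewrite ?jI //= addbF.
apply: PS => [i|]; last by apply: IH; have := cardsD1 j I; rewrite jI cI => -[].
by rewrite !inE => /andP[ij iI]; rewrite ltn_neqAle ij; exact: jmax.
Qed.

Lemma cmonoM (x : 'I_n -> clifford F n) :
    (forall i, x i * x i = 1) ->
    (forall i j, i != j -> x i * x j = - (x j * x i)) ->
  forall I J, cmono x I * cmono x J = csign I J *: cmono x (symdiff I J).
Proof.
move=> x2 xa I; elim/set_max_ind => [|J j ltj IH].
  by rewrite cmono0 mulr1 csign0r scale1r symdiff0r.
rewrite cmonoS // mulrA IH -scalerAl cmonoMx // scalerA csignDr symdiffA.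
congr (_ * _ *: _); rewrite -[LHS]signr_odd inversionsDl.
by rewrite (inversions_lt0 ltj) cards0 addbF signr_odd.
Qed.

Lemma csign_set1 i j : csign [set i] [set j] = (-1) ^+ (j < i)%N.
Proof.
rewrite /csign inversions_set1r card_imset => [|i1 i2 [] //].
case: ltnP => ij; congr (_ ^+ _).
  by apply/eqP/cards1P; exists i; apply/setP => k; rewrite !inE; case: eqP => // ->.
apply/eqP; rewrite cards_eq0; apply/eqP/setP => k; rewrite !inE.
by case: eqP => // ->; rewrite ltnNge ij.
Qed.

Lemma cgen_sqr i : cgen i * cgen i = 1.
Proof.
rewrite cbasisM csign_set1 ltnn scale1r; congr cbasis.
by apply/setP => k; rewrite in_symdiff addbb inE.
Qed.

Lemma cgen_anticomm i j : i != j -> cgen i * cgen j = - (cgen j * cgen i).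
Proof.
move=> ij; rewrite !cbasisM !csign_set1 -scaleNr.
have -> : symdiff [set i] [set j] = symdiff [set j] [set i].
  by apply/setP => k; rewrite !in_symdiff addbC.
congr (_ *: _); have := ij; rewrite -val_eqE neq_ltn /=.
by case/orP => lt; rewrite lt ltnNge (ltnW lt) ?opprK.
Qed.

Lemma cbasis_prod I : cbasis I = \prod_(i in I) cgen i.
Proof.
rewrite -/(cmono cgen I); elim/set_max_ind: I => [|I j ltj IH].
  by rewrite cmono0.
rewrite cmonoS -?IH //; first by rewrite cbasisM /csign inversions_lt0 // cards0 scale1r.
- exact: cgen_sqr.
- exact: cgen_anticomm.
Qed.

End Clifford.

Section ParitySpace.
Variables (F : fieldType) (n : nat) (V : vectType F).

Definition parity_space (b : bool) : {vspace {ffun {set 'I_n} -> V}} :=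
  (\bigcap_(I : {set 'I_n} | odd #|I| != b) lker (ffun_ev V I))%VS.

Lemma parity_spaceP b (k : {ffun {set 'I_n} -> V}) :
  reflect (forall I : {set 'I_n}, odd #|I| != b -> k I = 0) (k \in parity_space b).
Proof.
apply: (iffP (memv_bigcapP _ _ _)) => H I /H; rewrite memv_ker ffun_evE.
  by move/eqP.
by move->.
Qed.

Lemma parity_space_grading : is_Z2grading parity_space.
Proof.
split.
  apply/eqP; rewrite -subv0; apply/subvP => k; rewrite memv_cap memv0.
  case/andP => /parity_spaceP k0 /parity_spaceP k1; apply/eqP/ffunP => I.
  rewrite ffunE; case oI: (odd #|I|); first by apply: k0; rewrite oI.
  by apply: k1; rewrite oI.
apply/eqP; rewrite eqEsubv subvf /=; apply/subvP => k _.
pose p (b : bool) : {ffun {set 'I_n} -> V} :=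
  [ffun I : {set 'I_n} => if odd #|I| == b then k I else 0].
have -> : k = p false + p true.
  by apply/ffunP => I; rewrite !ffunE; case: odd; rewrite ?addr0 ?add0r.
have P b : p b \in parity_space b.
  by apply/parity_spaceP => I /negPf oI; rewrite ffunE oI.
exact: memv_add (P false) (P true).
Qed.

End ParitySpace.

Section CliffordSuper.
Variables (F : fieldType) (n : nat).
Implicit Types (i j : 'I_n) (I J K : {set 'I_n}) (a b c : clifford F n).

Definition cliff_part (p : bool) : {vspace clifford F n} := parity_space n F^o p.

Lemma cliff_partP p a :
  reflect (forall I : {set 'I_n}, odd #|I| != p -> a I = 0) (a \in cliff_part p).
Proof. exact: parity_spaceP. Qed.

Lemma cliff_grading : is_Z2grading cliff_part.
Proof. exact: parity_space_grading. Qed.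

Lemma cbasis_part I : cbasis F I \in cliff_part (odd #|I|).
Proof.
apply/cliff_partP => J oJ; rewrite ffunE; case: eqP => // JI.
by rewrite JI eqxx in oJ.
Qed.

Lemma cliff_part1 : 1 \in cliff_part false.
Proof. by have := cbasis_part set0; rewrite cards0. Qed.

Lemma cliff_partM p q a b :
  a \in cliff_part p -> b \in cliff_part q -> a * b \in cliff_part (p (+) q).
Proof.
move=> /cliff_partP ap /cliff_partP bq.
apply: memv_suml => I _; apply: memv_suml => J _.
case: (eqVneq (odd #|I|) p) => [<-|/ap ->]; last by rewrite !mul0r scale0r mem0v.
case: (eqVneq (odd #|J|) q) => [<-|/bq ->]; last by rewrite mulr0 mul0r scale0r mem0v.
by apply: memvZ; rewrite -odd_symdiff cbasis_part.
Qed.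

Definition clifford_superalgebra : superalgebra F :=
  @Superalgebra F (clifford F n) cliff_part cliff_grading cliff_part1 cliff_partM.

End CliffordSuper.

(* (e, s) is the signed permutation c_i |-> (-1)^(e (s i)) c_(s i).  Products
   are composed from right to left: (e, s)(d, t) first applies (d, t).  As
   the product of MathComp permutations is composed from left to right, the
   composite of s and t is written [t * s]. *)
Definition hyperoct (n : nat) : Type := ({ffun 'I_n -> bool} * 'S_n)%type.

Section Hyperoct.
Variable n : nat.

HB.instance Definition _ := Finite.copy (hyperoct n) ({ffun 'I_n -> bool} * 'S_n)%type.

Implicit Types g h : hyperoct n.

Definition hmul g h : hyperoct n :=
  ([ffun j => g.1 j (+) h.1 ((g.2^-1)%g j)], (h.2 * g.2)%g).
Definition hone : hyperoct n := ([ffun=> false], 1%g).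
Definition hinv g : hyperoct n := ([ffun j => g.1 (g.2 j)], (g.2^-1)%g).

Lemma hmulA : associative hmul.
Proof.
move=> g h k; congr pair; rewrite /= ?mulgA //; apply/ffunP => j.
by rewrite !ffunE /= invMg permM addbA.
Qed.

Lemma hmul1g : left_id hone hmul.
Proof.
case=> e s; congr pair; rewrite /= ?mulg1 //.
by apply/ffunP => j; rewrite !ffunE invg1 perm1.
Qed.

Lemma hmulVg : left_inverse hone hinv hmul.
Proof.
case=> e s; congr pair; rewrite /= ?mulgV //.
by apply/ffunP => j; rewrite !ffunE /= invgK addbb.
Qed.

HB.instance Definition _ := Finite_isGroup.Build (hyperoct n) hmulA hmul1g hmulVg.

End Hyperoct.
Section SignedAction.
Variables (F : fieldType) (n : nat).
Implicit Types (i j : 'I_n) (I J : {set 'I_n}) (a b : clifford F n).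
Implicit Types g h : hyperoct n.

Definition signed_gen g i : clifford F n := (-1) ^+ g.1 (g.2 i) *: cgen F (g.2 i).

(* The action on c_I is forced by the action on the generators. *)
Definition cliff_act_fun g a : clifford F n :=
  \sum_I a I *: \prod_(i in I) signed_gen g i.

Lemma cliff_act_linear g : linear (cliff_act_fun g).
Proof.
move=> k a b; rewrite /cliff_act_fun scaler_sumr -big_split.
by apply: eq_bigr => I _ /=; rewrite !ffunE scalerA -scalerDl.
Qed.

Definition cliff_act g : 'End(clifford F n) := linfun (cliff_act_fun g).

Lemma cliff_act_basis g I : cliff_act g (cbasis F I) = cmono (signed_gen g) I.
Proof.
rewrite /cliff_act linfun_linE; last exact: cliff_act_linear.
rewrite /cliff_act_fun (bigD1 I) //= [X in _ + X]big1 ?addr0 => [|J /negPf nJ].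
  by rewrite ffunE eqxx scale1r.
by rewrite ffunE nJ scale0r.
Qed.

Lemma cliff_act_gen g i : cliff_act g (cgen F i) = signed_gen g i.
Proof. by rewrite cliff_act_basis /cmono big_set1. Qed.

Lemma signed_gen_sqr g i : signed_gen g i * signed_gen g i = 1.
Proof.
by rewrite -scalerAl -scalerAr scalerA -expr2 sqrr_sign scale1r cgen_sqr.
Qed.

Lemma signed_gen_anti g i j :
  i != j -> signed_gen g i * signed_gen g j = - (signed_gen g j * signed_gen g i).
Proof.
move=> ij; rewrite /signed_gen -!scalerAl -!scalerAr !scalerA mulrC -scalerN.
by rewrite cgen_anticomm ?inj_eq //; exact: perm_inj.
Qed.

Lemma cliff_act_mul g a b : cliff_act g (a * b) = cliff_act g a * cliff_act g b.
Proof.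
apply: (clifford_lin_ext (f := fun a => cliff_act g (a * b))
                         (g := fun a => cliff_act g a * cliff_act g b)).
- by move=> k x y; rewrite mulrDl -scalerAl linearP.
- by move=> k x y; rewrite linearP mulrDl -scalerAl.
move=> I {a}.
apply: (clifford_lin_ext (f := fun b => cliff_act g (cbasis F I * b))
                         (g := fun b => cliff_act g (cbasis F I) * cliff_act g b)).
- by move=> k x y; rewrite mulrDr -scalerAr linearP.
- by move=> k x y; rewrite linearP mulrDr -scalerAr.
move=> J {b}; rewrite cbasisM linearZ /= !cliff_act_basis cmonoM //.
- exact: signed_gen_sqr.
- exact: signed_gen_anti.
Qed.

Lemma cliff_act_one g : cliff_act g 1 = 1.
Proof. by rewrite cliff_act_basis cmono0. Qed.

Lemma cliff_act_prod g (x : 'I_n -> clifford F n) I :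
  cliff_act g (\prod_(i in I) x i) = \prod_(i in I) cliff_act g (x i).
Proof.
exact: (big_morph (cliff_act g) (cliff_act_mul g) (cliff_act_one g)).
Qed.

Lemma cliff_act1 a : cliff_act 1%g a = a.
Proof.
apply: (clifford_lin_ext (f := cliff_act 1%g) (g := id)) => //; first exact: linearP.
move=> I; rewrite cliff_act_basis cbasis_prod; apply: eq_bigr => i _.
by rewrite /signed_gen /= ffunE perm1 scale1r.
Qed.

Lemma cliff_actM g h a : cliff_act (g * h)%g a = cliff_act g (cliff_act h a).
Proof.
apply: (clifford_lin_ext (f := cliff_act (g * h)%g)
                         (g := fun a => cliff_act g (cliff_act h a))).
- exact: linearP.
- by move=> k x y; rewrite !linearP.
move=> I; rewrite !cliff_act_basis /cmono cliff_act_prod; apply: eq_bigr => i _.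
rewrite /signed_gen linearZ /= -/(cgen F _) cliff_act_gen scalerA /= ffunE.
by rewrite permM permK signr_addb mulrC.
Qed.

Lemma signed_gen_part g i : signed_gen g i \in cliff_part F n true.
Proof. by apply: memvZ; have := cbasis_part F [set g.2 i]; rewrite cards1. Qed.

Lemma cmono_part g I : cmono (signed_gen g) I \in cliff_part F n (odd #|I|).
Proof.
elim/set_max_ind: I => [|I j ltj IH]; first by rewrite cmono0 cards0 cliff_part1.
rewrite cmonoS //; try exact: signed_gen_sqr; try exact: signed_gen_anti.
by rewrite odd_symdiff cards1; apply: cliff_partM IH (signed_gen_part g j).
Qed.

Lemma cliff_act_part g p a :
  a \in cliff_part F n p -> cliff_act g a \in cliff_part F n p.
Proof.
move=> /cliff_partP ap; rewrite /cliff_act linfun_linE; last exact: cliff_act_linear.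
apply: memv_suml => I _.
case: (eqVneq (odd #|I|) p) => [<-|/ap ->]; last by rewrite scale0r mem0v.
exact: memvZ (cmono_part g I).
Qed.

Definition cliff_superaction :
    superaction (hyperoct n) (clifford_superalgebra F n) :=
  @SuperAction F (hyperoct n) (clifford_superalgebra F n) cliff_act
    cliff_act1 cliff_actM cliff_act_one cliff_act_mul cliff_act_part.

Definition hecke_clifford : superalgebra F := smash_superalgebra cliff_superaction.

End SignedAction.

(* For a purely even representation W of B_n, Cl_n (x) W is realised as the
   functions from the basis (c_I) of Cl_n to W; [tens a w] is a (x) w. *)
Section CliffordTensor.
Variables (F : fieldType) (n : nat) (W : lrep F (hyperoct n)).
Implicit Types (I J : {set 'I_n}) (a b : clifford F n) (w : W).
Implicit Types (x y : hecke_clifford F n) (g h : hyperoct n).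

Definition ctensor : Type := {ffun {set 'I_n} -> W}.

HB.instance Definition _ := Vector.copy ctensor {ffun {set 'I_n} -> W}.

Implicit Types k : ctensor.

Definition tens a w : ctensor := [ffun I => (a I : F) *: w].

Lemma tens_linearl w : linear (tens^~ w).
Proof. by move=> c a b; apply/ffunP => I; rewrite !ffunE scalerA -scalerDl. Qed.

Lemma tens_linearr a : linear (tens a).
Proof.
by move=> c v w; apply/ffunP => I; rewrite !ffunE scalerDr !scalerA mulrC.
Qed.

Lemma ctensor_expand k : k = \sum_I tens (cbasis F I) (k I).
Proof.
apply/ffunP => J; rewrite sum_ffunE (bigD1 J) //= big1 ?addr0 => [|I /negPf IJ].
  by rewrite !ffunE eqxx scale1r.
by rewrite !ffunE eq_sym IJ scale0r.
Qed.

(* a g . (b (x) w) = a (g b) (x) g w *)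
Definition ctensor_act_fun x k : ctensor :=
  \sum_g \sum_I tens (x g * cliff_act F g (cbasis F I)) (lr_act W g (k I)).

Lemma ctensor_act_linear x : linear (ctensor_act_fun x).
Proof.
move=> c k k'; rewrite /ctensor_act_fun scaler_sumr -big_split.
apply: eq_bigr => g _ /=; rewrite scaler_sumr -big_split; apply: eq_bigr => I _ /=.
by rewrite !ffunE linearP tens_linearr.
Qed.

Definition ctensor_act x : 'End(ctensor) := linfun (ctensor_act_fun x).

Lemma ctensor_actE x k : ctensor_act x k = ctensor_act_fun x k.
Proof. by rewrite /ctensor_act linfun_linE //; exact: ctensor_act_linear. Qed.

Lemma ctensor_act_tens x b w :
  ctensor_act x (tens b w) =
  \sum_g tens (x g * cliff_act F g b) (lr_act W g w).
Proof.
rewrite ctensor_actE; apply: eq_bigr => g _.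
have lt := GRing.scalable_linear (tens_linearl (lr_act W g w)).
apply/esym.
apply: (clifford_lin_ext (V := ctensor)
  (f := fun b => tens (x g * cliff_act F g b) (lr_act W g w))
  (g := fun b => \sum_I tens (x g * cliff_act F g (cbasis F I))
                         (lr_act W g (tens b w I)))).
- by move=> c a a'; rewrite linearP mulrDr -scalerAr tens_linearl.
- move=> c a a'; rewrite scaler_sumr -big_split; apply: eq_bigr => I _ /=.
  by rewrite tens_linearl !ffunE linearP tens_linearr.
move=> I; rewrite (bigD1 I) //= big1 ?addr0 => [|J /negPf nJ].
  by rewrite ffunE ffunE eqxx scale1r.
rewrite ffunE ffunE nJ scale0r linear0.
by apply/ffunP => K; rewrite !ffunE scaler0.
Qed.

Lemma ctensor_act_elt a g b w :
  ctensor_act (smash_elt (cliff_superaction F n) a g) (tens b w) =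
  tens (a * cliff_act F g b) (lr_act W g w).
Proof.
rewrite ctensor_act_tens (bigD1 g) //= big1 ?addr0 => [|h /negPf hg].
  by rewrite ffunE eqxx.
by rewrite ffunE hg mul0r; apply/ffunP => I; rewrite !ffunE scale0r.
Qed.

Lemma ctensor_lin_ext (f1 f2 : ctensor -> ctensor) : linear f1 -> linear f2 ->
  (forall a w, f1 (tens a w) = f2 (tens a w)) -> f1 =1 f2.
Proof.
move=> l1 l2 f12 k.
have sumE f : linear f -> f k = \sum_I f (tens (cbasis F I) (k I)) :> ctensor.
  move=> lf; rewrite -(linfun_linE k lf) {1}(ctensor_expand k) linear_sum.
  by apply: eq_bigr => I _; exact: linfun_linE.
by rewrite !sumE //; apply: eq_bigr => I _; rewrite f12.
Qed.

Lemma ctensor_act1 k : ctensor_act 1 k = k.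
Proof.
apply: (ctensor_lin_ext (f1 := ctensor_act 1) (f2 := id)) => //.
  exact: linearP.
move=> a w; rewrite ctensor_act_tens (bigD1 1%g) //= big1 ?addr0 => [|g /negPf g1].
  by rewrite ffunE eqxx mul1r cliff_act1 lr_act1.
by rewrite ffunE g1 mul0r; apply/ffunP => I; rewrite !ffunE scale0r.
Qed.

Lemma tens_suml (T : finType) (u : T -> clifford F n) w :
  tens (\sum_t u t) w = \sum_t tens (u t) w.
Proof.
by apply/ffunP => I; rewrite !ffunE !sum_ffunE scaler_suml; apply: eq_bigr => t _; rewrite ffunE.
Qed.

Lemma ctensor_actM x y k : ctensor_act (x * y) k = ctensor_act x (ctensor_act y k).
Proof.
apply: (ctensor_lin_ext (f1 := ctensor_act (x * y))
                        (f2 := fun k => ctensor_act x (ctensor_act y k))).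
- exact: linearP.
- by move=> c v w; rewrite !linearP.
move=> a w; rewrite !ctensor_act_tens linear_sum /=.
under [RHS]eq_bigr => h _ do rewrite ctensor_act_tens.
under [LHS]eq_bigr => h _ do rewrite ffunE mulr_suml tens_suml.
rewrite exchange_big [RHS]exchange_big; apply: eq_bigr => g _ /=.
rewrite (reindex_inj (mulgI g)); apply: eq_bigr => h _ /=.
by rewrite mulKg cliff_act_mul -cliff_actM -lr_actM mulrA.
Qed.

Lemma ctensor_act_lin : linear ctensor_act.
Proof.
move=> c x y; apply/lfunP => k; rewrite !lfunE /= lfunE /= !ctensor_actE.
rewrite /ctensor_act_fun scaler_sumr -big_split; apply: eq_bigr => g _ /=.
rewrite scaler_sumr -big_split; apply: eq_bigr => I _ /=.
by rewrite !ffunE mulrDl -scalerAl tens_linearl.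
Qed.

Definition ctensor_part (p : bool) : {vspace ctensor} := parity_space n W p.

Lemma ctensor_grading : is_Z2grading ctensor_part.
Proof. exact: parity_space_grading. Qed.

Lemma tens_part p a w : a \in cliff_part F n p -> tens a w \in ctensor_part p.
Proof.
move=> /cliff_partP ap; apply/parity_spaceP => I oI.
by rewrite ffunE ap // scale0r.
Qed.

Lemma ctensor_act_part i j x k :
  x \in sa_part (hecke_clifford F n) i -> k \in ctensor_part j ->
  ctensor_act x k \in ctensor_part (i (+) j).
Proof.
move=> /smash_partP xi /parity_spaceP kj; rewrite ctensor_actE.
apply: memv_suml => g _; apply: memv_suml => I _.
case: (eqVneq (odd #|I|) j) => [<-|/kj ->]; last first.
  by rewrite linear0; apply/parity_spaceP => J _; rewrite ffunE scaler0.
apply: tens_part; apply: cliff_partM; first exact: xi.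
by apply: cliff_act_part; exact: cbasis_part.
Qed.

Definition clifford_smodule : smodule (hecke_clifford F n) :=
  @SModule F (hecke_clifford F n) ctensor ctensor_part ctensor_act
    ctensor_grading ctensor_act_lin ctensor_act1 ctensor_actM ctensor_act_part.

End CliffordTensor.

Record intpart (n : nat) := IntPart {
  parts :> seq nat;
  parts_sorted : sorted geq parts;
  parts_gt0 : 0%N \notin parts;
  parts_sum : sumn parts = n
}.

Section Specht.
Variables (F : fieldType) (n : nat) (la : seq nat).

(* A tableau gives the position (row, column) of each entry 0, .., n-1; a
   tabloid only gives the rows. *)
Notation tableau := {ffun 'I_n -> 'I_n * 'I_n}.
Notation tabloid := {ffun 'I_n -> 'I_n}.

(* When |la| = n, the n boxes of la are then all filled. *)
Definition is_tableau (t : tableau) : bool :=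
  injectiveb t && [forall k, ((t k).2 < nth 0%N la (t k).1)%N].

Definition tabloid_of (t : tableau) : tabloid := [ffun k => (t k).1].

(* [permute s t] replaces each entry k by [s k]. *)
Definition permute (T : Type) (s : 'S_n) (t : {ffun 'I_n -> T}) : {ffun 'I_n -> T} :=
  [ffun k => t ((s^-1)%g k)].

Definition col_stab (t : tableau) : {set 'S_n} :=
  [set s : 'S_n | [forall k, (t (s k)).2 == (t k).2]].

Definition tabloid_space : Type := {ffun tabloid -> F^o}.

HB.instance Definition _ := Vector.copy tabloid_space {ffun tabloid -> F^o}.

Definition tabloid_vec (d : tabloid) : tabloid_space := [ffun d' => (d' == d)%:R].

Definition polytabloid (t : tableau) : tabloid_space :=
  \sum_(s in col_stab t) (-1) ^+ s *: tabloid_vec (permute s (tabloid_of t)).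

Definition specht : {vspace tabloid_space} :=
  <<[seq polytabloid t | t <- enum is_tableau]>>%VS.

Definition tabloid_act_fun (s : 'S_n) (v : tabloid_space) : tabloid_space :=
  [ffun d => v (permute (s^-1)%g d)].

Lemma tabloid_act_linear s : linear (tabloid_act_fun s).
Proof. by move=> c u v; apply/ffunP => d; rewrite !ffunE. Qed.

Definition tabloid_act s : 'End(tabloid_space) := linfun (tabloid_act_fun s).

Lemma tabloid_actE s v : tabloid_act s v = tabloid_act_fun s v.
Proof. by rewrite /tabloid_act linfun_linE //; exact: tabloid_act_linear. Qed.

Lemma permute1 (T : Type) (t : {ffun 'I_n -> T}) : permute 1%g t = t.
Proof. by apply/ffunP => k; rewrite ffunE invg1 perm1. Qed.

Lemma permuteM (T : Type) (s u : 'S_n) (t : {ffun 'I_n -> T}) :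
  permute (u * s)%g t = permute s (permute u t).
Proof. by apply/ffunP => k; rewrite !ffunE invMg permM. Qed.

Lemma tabloid_act_vec s d : tabloid_act s (tabloid_vec d) = tabloid_vec (permute s d).
Proof.
rewrite tabloid_actE; apply/ffunP => d'; rewrite !ffunE; congr (_%:R).
congr nat_of_bool; apply/eqP/eqP => [<-|->].
  by rewrite -permuteM mulVg permute1.
by rewrite -permuteM mulgV permute1.
Qed.

Lemma tabloid_act_polytabloid s t :
  tabloid_act s (polytabloid t) = polytabloid (permute s t).
Proof.
rewrite linear_sum /= [RHS](reindex_inj (conjg_inj s)) /=.
apply: eq_big => [u|u _].
  rewrite !inE; apply/forallP/forallP => H k.
    rewrite !ffunE conjgE !permM permK; exact: H.
  by have := H (s k); rewrite !ffunE conjgE !permM !permK.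
rewrite linearZ /= tabloid_act_vec odd_permJ; congr (_ *: tabloid_vec _).
by apply/ffunP => k; rewrite !ffunE conjgE !invMg invgK !permM permK.
Qed.

Lemma is_tableau_permute s t : is_tableau t -> is_tableau (permute s t).
Proof.
case/andP => /injectiveP ti /forallP tla; apply/andP; split.
  by apply/injectiveP => i j; rewrite !ffunE => /ti /perm_inj.
by apply/forallP => k; rewrite ffunE.
Qed.

Lemma specht_stable s v : v \in specht -> tabloid_act s v \in specht.
Proof.
move=> vS; have : tabloid_act s v \in (tabloid_act s @: specht)%VS by exact: memv_img.
apply: subvP; rewrite /specht limg_span; apply/span_subvP => _ /mapP[_ /mapP[t tT ->] ->].
rewrite tabloid_act_polytabloid; apply: memv_span; apply: map_f.
by move: tT; rewrite !mem_enum; exact: is_tableau_permute.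
Qed.

(* B_n acts through its projection onto S_n. *)
Definition specht_act_fun (g : hyperoct n) (v : subvs_of specht) : subvs_of specht :=
  vsproj specht (tabloid_act g.2 (vsval v)).

Lemma specht_act_linear g : linear (specht_act_fun g).
Proof. by move=> c u v; rewrite /specht_act_fun !linearP. Qed.

Definition specht_act g : 'End(subvs_of specht) := linfun (specht_act_fun g).

Lemma specht_actE g v : vsval (specht_act g v) = tabloid_act g.2 (vsval v).
Proof.
rewrite /specht_act linfun_linE; last exact: specht_act_linear.
by rewrite vsprojK // specht_stable // subvsP.
Qed.

Lemma specht_act1 v : specht_act 1%g v = v.
Proof.
apply: val_inj; rewrite /= specht_actE tabloid_actE; apply/ffunP => d.
by rewrite ffunE invg1 permute1.
Qed.

Lemma specht_actM g h v : specht_act (g * h)%g v = specht_act g (specht_act h v).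
Proof.
apply: val_inj; rewrite /= !specht_actE !tabloid_actE; apply/ffunP => d.
by rewrite !ffunE invMg permuteM.
Qed.

Definition specht_lrep : lrep F (hyperoct n) :=
  @LRep F (hyperoct n) (subvs_of specht) specht_act specht_act1 specht_actM.

End Specht.

Definition Kmod (F : fieldType) (n : nat) (la : intpart n) :
  smodule (hecke_clifford F n) := clifford_smodule (specht_lrep F n la).

(* Main.v *)
Require Import Defs.
From mathcomp Require Import all_boot all_order all_fingroup all_algebra all_field.
From mathcomp Require Import pgroup mxrepresentation complex boolp reals.

Set Implicit Arguments.
Unset Strict Implicit.
Unset Printing Implicit Defensive.

Import GRing.Theory Num.Theory VectorInternalTheory.
Local Open Scope ring_scope.

(** Two independent facts combine.

    Sign group.  On Cl_n the sign changes act by pairwise distinct characters,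
    one for each monomial c_I, and left multiplication by c_J permutes the
    monomials up to sign.  So Cl_n with the signs is a full matrix algebra
    acting on Cl_n, and a module M over Cl_n x| B_n is Cl_n (x) M0, where M0 is
    the space of vectors fixed by all sign changes, a module over S_n.
    Concretely, let p be the idempotent of the trivial sign character.  The
    conjugates c_I p c_I^-1 add up to 1 ([sign_idem_resolution]), so p M is
    nonzero when M is; on Cl_n (x) W the idempotent p is the projection onto
    1 (x) W ([clifford_act_sign_idem]), so submodules and homogeneous maps are
    controlled by their traces on 1 (x) W ([clifford_smodule_simple],
    [clifford_hom_restrict]); and a map from W to the sign invariants of M
    extends to Cl_n (x) W ([clifford_smodule_lift]).  As p is even and 1 (x) W
    lies in even degree, Cl_n (x) W has no odd endomorphism, whence type M.  In
    an arbitrary simple M the invariants may sit in odd degree, which is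
    absorbed by an odd isomorphism.

    Specht modules.  They are simple, pairwise inequivalent, and exhaust the
    simple modules of S_n.  The first two follow James: the column
    antisymmetrizer of a tableau t of shape la sends every element of S^la to a
    multiple of the polytabloid of t ([col_antisym_specht]).  In place of the
    dominance order, shapes are compared through the single number
    n(la) = sum_i i la_i, the sum of the row indices over the boxes: among all
    ways to give distinct rows to the entries of each column, the tableau
    itself minimizes this sum, and only its column permutations attain the
    minimum ([tabloid_sum_ge]).  Exhaustion is a count: over an algebraically
    closed field of characteristic 0 there are as many simple modules as
    conjugacy classes, and the cycle type separates the classes
    ([cycle_type_conj], [irr_comp_specht]). *)

(** * Partitions and tableaux *)

Section Partitions.
Variable n : nat.
Implicit Types la mu : intpart n.

Lemma intpart_nth_mono la i k : (i <= k)%N -> (nth 0%N la k <= nth 0%N la i)%N.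
Proof.
move=> ik; case: (ltnP k (size la)) => [kla|]; last by move/(nth_default _)->.
apply: (sorted_leq_nth (leT := geq) _ _ 0%N (parts_sorted la)) => //.
- by move=> a b c /= ba cb; exact: leq_trans cb ba.
- exact: leqnn.
- exact: leq_ltn_trans kla.
Qed.

Lemma sumn_ge_size (s : seq nat) : 0%N \notin s -> (size s <= sumn s)%N.
Proof.
elim: s => //= a s IH; rewrite inE negb_or => /andP[a0 /IH le].
by rewrite -add1n leq_add // lt0n eq_sym.
Qed.

Lemma intpart_size la : (size la <= n)%N.
Proof. by rewrite -{2}(parts_sum la) sumn_ge_size // parts_gt0. Qed.

Lemma intpart_sum la : (\sum_(i < n) nth 0%N la i = n)%N.
Proof.
rewrite -[RHS](parts_sum la) sumnE (big_nth 0%N) big_mkord.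
rewrite (big_ord_widen n (fun i => nth 0%N la i) (intpart_size la)) [RHS]big_mkcond.
by apply: eq_bigr => i _; case: ltnP => // /(nth_default _) ->.
Qed.

Lemma intpart_nth_le la (i : nat) : (nth 0%N la i <= n)%N.
Proof.
case: (ltnP i n) => [ltin|le].
  by rewrite -{2}(intpart_sum la) (bigD1 (Ordinal ltin)) //= leq_addr.
by rewrite nth_default // (leq_trans (intpart_size la)).
Qed.

Lemma intpart_ext la mu : (forall i : 'I_n, nth 0%N la i = nth 0%N mu i) -> la = mu.
Proof.
move=> eqlm.
have lt_size (l m : intpart n) : (forall i : 'I_n, nth 0%N l i = nth 0%N m i) ->
    ~~ (size l < size m)%N.
  move=> elm; apply/negP => ltlm.
  have := parts_gt0 m; have := elm (Ordinal (leq_trans ltlm (intpart_size m))).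
  by rewrite /= nth_default // => ->; rewrite mem_nth.
have eqs : parts la = parts mu.
  apply: (@eq_from_nth _ 0%N) => [|i ila].
    have [lt|lt|//] := ltngtP (size la) (size mu).
      by case/negP: (lt_size _ _ eqlm).
    by case/negP: (lt_size mu la (fun i => esym (eqlm i))).
  exact: (eqlm (Ordinal (leq_trans ila (intpart_size la)))).
case: la mu eqs {eqlm} => [s s1 s2 s3] [s' s1' s2' s3'] /= eqs.
case: s' / eqs s1' s2' s3' => s1' s2' s3'.
by rewrite (bool_irrelevance s1 s1') (bool_irrelevance s2 s2') (eq_irrelevance s3 s3').
Qed.

Definition cells la : {set 'I_n * 'I_n} := [set p : 'I_n * 'I_n | (p.2 < nth 0%N la p.1)%N].

Lemma card_row_cells la (i : 'I_n) : #|[set j : 'I_n | (j < nth 0%N la i)%N]| = nth 0%N la i.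
Proof.
rewrite -sum1dep_card -(big_ord_widen n (fun _ => 1%N) (intpart_nth_le la i)).
by rewrite sum1_card card_ord.
Qed.

Lemma card_cells la : #|cells la| = n.
Proof.
rewrite -sum1dep_card -(pair_big_dep xpredT (fun (i j : 'I_n) => (j < nth 0%N la i)%N)
  (fun _ _ => 1%N)) /= -[RHS](intpart_sum la).
by apply: eq_bigr => i _; rewrite -[RHS]card_row_cells sum1dep_card.
Qed.

Lemma tableau_codom la (t : {ffun 'I_n -> 'I_n * 'I_n}) :
  is_tableau la t -> [set t k | k in 'I_n] = cells la.
Proof.
case/andP => /injectiveP ti /forallP tla; apply/eqP.
rewrite eqEcard card_imset // card_cells card_ord leqnn andbT.
by apply/subsetP => _ /imsetP[k _ ->]; rewrite inE.
Qed.

Lemma tableau_exists la : exists t : {ffun 'I_n -> 'I_n * 'I_n}, is_tableau la t.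
Proof.
have e : n = #|cells la| by rewrite card_cells.
exists [ffun k => enum_val (cast_ord e k)]; apply/andP; split.
  by apply/injectiveP => i j; rewrite !ffunE => /enum_val_inj /cast_ord_inj.
by apply/forallP => k; rewrite ffunE; have := enum_valP (cast_ord e k); rewrite inE.
Qed.

Lemma card_tableau_row la (t : {ffun 'I_n -> 'I_n * 'I_n}) (i : 'I_n) :
  is_tableau la t -> #|[set k | (t k).1 == i]| = nth 0%N la i.
Proof.
move=> tT; have ti : injective t by case/andP: tT => /injectiveP.
rewrite -card_row_cells -(card_imset _ ti).
rewrite -(card_imset [set j : 'I_n | _] (can_inj (fun j => erefl : (i, j).2 = j))).
congr #|pred_of_set _|; apply/setP => -[a b]; apply/imsetP/imsetP.
  case=> k; rewrite inE => /eqP <- tk.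
  exists b; last by rewrite -tk.
  by have := imset_f t (isT : k \in 'I_n); rewrite (tableau_codom tT) !inE -tk.
case=> c; rewrite inE => ci [-> ->].
have : (i, c) \in [set t k | k in 'I_n] by rewrite (tableau_codom tT) inE.
by case/imsetP => k _ tk; exists k => //; rewrite inE -tk.
Qed.

(** Exchanging the elements of [B :\: A] for those of [A :\: B], which are
    smaller because [A] is an initial segment, can only lower the sum. *)
Lemma sum_initial_segment (A B : {set 'I_n}) :
  (forall i k : 'I_n, i \in A -> (k < i)%N -> k \in A) -> #|A| = #|B| ->
  (\sum_(i in A) i + #|B :\: A| <= \sum_(i in B) i)%N.
Proof.
move=> seg cAB.
have cD : #|A :\: B| = #|B :\: A|.
  apply/eqP; rewrite -(eqn_add2l #|A :&: B|) cardsID cAB.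
  by rewrite setIC cardsID.
rewrite (big_setID B) [X in (_ <= X)%N](big_setID A) /= setIC -addnA leq_add2l.
case: (set_0Vmem (B :\: A)) => [e|[m0 m0D]].
  by move: cD; rewrite e cards0 => /eqP; rewrite cards_eq0 => /eqP ->; rewrite !big_set0.
case: (arg_minnP (fun i : 'I_n => (i : nat)) m0D) => m mD mmin.
have {m0 m0D} mD' : m \in B :\: A := mD.
have ltm i : i \in A :\: B -> (i < m)%N.
  rewrite inE => /andP[iB iA]; rewrite ltnNge; apply/negP => mi.
  move: mD'; rewrite inE => /andP[mA mB].
  move: mi; rewrite leq_eqVlt => /orP[/eqP e|mi]; last by rewrite (seg i) in mA.
  by move: mA; rewrite (val_inj e : m = i) iA.
apply: (@leq_trans (\sum_(i in B :\: A) m)%N); last exact: leq_sum.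
rewrite sum_nat_const -cD -[X in (_ + X <= _)%N]sum1_card -big_split /=.
rewrite -sum_nat_const; apply: leq_sum => i iD; rewrite addn1; exact: ltm.
Qed.

(** The rows occupied by a column of a tableau form an initial segment, so
    their sum is minimal among all assignments of distinct rows to the entries
    of that column.  Equality in every column forces the same sets of rows,
    that is, a rearrangement of each column. *)
Lemma tabloid_sum_ge la (t : {ffun 'I_n -> 'I_n * 'I_n}) (d : {ffun 'I_n -> 'I_n}) :
  is_tableau la t ->
  (forall x y, (t x).2 = (t y).2 -> d x = d y -> x = y) ->
  (\sum_x (t x).1 <= \sum_x d x)%N /\
  ((\sum_x d x <= \sum_x (t x).1)%N ->
     exists2 s, s \in col_stab t & d = permute s (tabloid_of t)).
Proof.
move=> tT dinj; have ti : injective t by case/andP: (tT) => /injectiveP.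
pose C j := [set x | (t x).2 == j].
pose A j : {set 'I_n} := [set (t x).1 | x in C j].
pose B j : {set 'I_n} := [set d x | x in C j].
have injA j : {in C j &, injective (fun x => (t x).1)}.
  move=> x y; rewrite !inE => /eqP xj /eqP yj e; apply: ti.
  by rewrite (surjective_pairing (t x)) e xj -yj -surjective_pairing.
have injB j : {in C j &, injective d}.
  by move=> x y; rewrite !inE => /eqP xj /eqP yj; apply: dinj; rewrite xj.
have cAB j : #|A j| = #|B j| by rewrite !card_in_imset.
have seg j (i k : 'I_n) : i \in A j -> (k < i)%N -> k \in A j.
  case/imsetP => x; rewrite inE => /eqP xj -> ki.
  have xc : t x \in cells la by rewrite -(tableau_codom tT) imset_f.
  have : (k, j) \in [set t k | k in 'I_n].
    rewrite (tableau_codom tT) inE /= -xj; move: xc; rewrite inE => /leq_trans; apply.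
    exact: intpart_nth_mono (ltnW ki).
  case/imsetP => y _ ty; apply/imsetP; exists y; rewrite ?inE -ty //=.
have sumA : (\sum_x (t x).1 = \sum_j \sum_(i in A j) i)%N.
  rewrite (partition_big (fun x => (t x).2) xpredT) //=; apply: eq_bigr => j _.
  by rewrite big_imset //=; apply: eq_bigl => x; rewrite inE.
have sumB : (\sum_x d x = \sum_j \sum_(i in B j) i)%N.
  rewrite (partition_big (fun x => (t x).2) xpredT) //=; apply: eq_bigr => j _.
  by rewrite big_imset //=; apply: eq_bigl => x; rewrite inE.
have leAB j := sum_initial_segment (seg j) (cAB j).
have le : (\sum_x (t x).1 + \sum_j #|B j :\: A j| <= \sum_x d x)%N.
  by rewrite sumA sumB -big_split; apply: leq_sum => j _; exact: leAB.
split=> [|ge]; first exact: leq_trans (leq_addr _ _) le.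
have : (\sum_j #|B j :\: A j| <= 0)%N.
  by rewrite -(leq_add2l (\sum_x (t x).1)%N) addn0 (leq_trans le).
rewrite leqn0 sum_nat_eq0 => /forallP D0.
have /fin_all_exists [f fP] x : exists y, t y = (d x, (t x).2).
  have : d x \in A (t x).2.
    have := D0 (t x).2; rewrite implyTb cards_eq0 setD_eq0 => /subsetP; apply.
    by apply/imsetP; exists x; rewrite ?inE.
  case/imsetP => y; rewrite inE => /eqP y2 ->; exists y; rewrite -y2.
  exact: surjective_pairing.
have finj : injective f.
  move=> x y /(congr1 t); rewrite !fP => -[dxy txy]; exact: dinj.
exists (perm finj)^-1%g; last by apply/ffunP => x; rewrite !ffunE invgK permE fP.
rewrite inE; apply/forallP => k; rewrite -{2}(permKV (perm finj) k) permE fP //.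
Qed.

End Partitions.

(** * Column antisymmetrizers *)

Section Antisymmetrizer.
Variables (F : numFieldType) (n : nat).
Notation tableau := {ffun 'I_n -> 'I_n * 'I_n}.
Notation tabloid := {ffun 'I_n -> 'I_n}.
Implicit Types (t : tableau) (d : tabloid) (s : 'S_n) (v : tabloid_space F n).
Implicit Types la mu : intpart n.

Lemma tabloid_actM s s' v :
  tabloid_act F (s * s')%g v = tabloid_act F s' (tabloid_act F s v).
Proof.
by rewrite !tabloid_actE; apply/ffunP => d; rewrite !ffunE invMg permuteM.
Qed.

Lemma tabloid_act1 v : tabloid_act F 1%g v = v.
Proof. by rewrite tabloid_actE; apply/ffunP => d; rewrite !ffunE invg1 permute1. Qed.

Lemma tabloid_expand v : v = \sum_d v d *: tabloid_vec F d.
Proof.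
apply/ffunP => e; rewrite sum_ffunE (bigD1 e) //= big1 ?addr0 => [|d /negPf de].
  by rewrite !ffunE eqxx [_ *: _]mulr1.
by rewrite !ffunE eq_sym de [_ *: _]mulr0.
Qed.

Lemma col_stabM t s s' : s \in col_stab t ->
  ((s * s')%g \in col_stab t) = (s' \in col_stab t).
Proof.
rewrite !inE => /forallP sC; apply/forallP/forallP => H k.
  by have := H (s^-1%g k); rewrite permM permKV => /eqP ->; rewrite -(eqP (sC _)) permKV.
by rewrite permM (eqP (H _)) sC.
Qed.

Lemma col_stab1 t : 1%g \in col_stab t.
Proof. by rewrite inE; apply/forallP => k; rewrite perm1. Qed.

Definition col_antisym t : 'End(tabloid_space F n) :=
  \sum_(s in col_stab t) (-1) ^+ s *: tabloid_act F s.

Lemma col_antisymE t v :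
  col_antisym t v = \sum_(s in col_stab t) (-1) ^+ s *: tabloid_act F s v.
Proof. by rewrite sum_lfunE; apply: eq_bigr => s _; rewrite scale_lfunE. Qed.

Lemma col_antisym_vec t :
  col_antisym t (tabloid_vec F (tabloid_of t)) = polytabloid F t.
Proof. by rewrite col_antisymE; apply: eq_bigr => s _; rewrite tabloid_act_vec. Qed.

Lemma col_antisym_act t s v : s \in col_stab t ->
  col_antisym t (tabloid_act F s v) = (-1) ^+ s *: col_antisym t v.
Proof.
move=> sC; rewrite !col_antisymE scaler_sumr [RHS](reindex_inj (mulgI s)) /=.
apply: eq_big => [s'|s' _]; first by rewrite col_stabM.
by rewrite scalerA tabloid_actM odd_permM signr_addb mulrA -signr_addb addbb mul1r.
Qed.

Lemma col_antisym_tabloidM t s : s \in col_stab t ->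
  col_antisym t (tabloid_vec F (permute s (tabloid_of t))) = (-1) ^+ s *: polytabloid F t.
Proof. by move=> sC; rewrite -tabloid_act_vec col_antisym_act // col_antisym_vec. Qed.

Lemma col_antisym_polytabloid t :
  col_antisym t (polytabloid F t) = #|col_stab t|%:R *: polytabloid F t.
Proof.
rewrite {1}/polytabloid linear_sum /= scaler_nat -sumr_const.
apply: eq_bigr => s sC; rewrite linearZ /= col_antisym_tabloidM //.
by rewrite scalerA -signr_addb addbb scale1r.
Qed.

Lemma card_col_stab_neq0 t : #|col_stab t|%:R != 0 :> F.
Proof. by rewrite pnatr_eq0 -lt0n; apply/card_gt0P; exists 1%g; exact: col_stab1. Qed.

(** A tabloid with two entries of a column of [t] in the same row is fixed by
    an odd element of the column stabilizer. *)
Lemma col_antisym_eq0 t d x y : x != y -> (t x).2 = (t y).2 -> d x = d y ->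
  col_antisym t (tabloid_vec F d) = 0.
Proof.
move=> xy txy dxy.
have tC : tperm x y \in col_stab t.
  by rewrite inE; apply/forallP => k; case: tpermP => [->|->|]; rewrite ?txy.
have := col_antisym_act (tabloid_vec F d) tC.
rewrite tabloid_act_vec odd_tperm xy expr1 scaleN1r.
have -> : permute (tperm x y) d = d.
  apply/ffunP => k; rewrite ffunE tpermV; case: tpermP => [->|->|] //.
move/eqP; rewrite -addr_eq0 -mulr2n -scaler_nat scaler_eq0 pnatr_eq0 /=.
by move/eqP.
Qed.

Lemma col_antisym_neq0 t v : col_antisym t v != 0 ->
  exists2 d, v d != 0 & forall x y, (t x).2 = (t y).2 -> d x = d y -> x = y.
Proof.
move=> nz; pose good d :=
  [forall x, forall y, ((t x).2 == (t y).2) && (d x == d y) ==> (x == y)].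
have [|none] := boolP [exists d, (v d != 0) && good d].
  case/existsP => d /andP[vd /forallP gd]; exists d => // x y txy dxy.
  by have /forallP/(_ y) := gd x; rewrite txy dxy !eqxx => /eqP.
case/eqP: nz; rewrite (tabloid_expand v) linear_sum big1 // => d _.
rewrite linearZ /=; apply/eqP; rewrite scaler_eq0; apply/orP.
case: (eqVneq (v d) 0) => [|vd]; [by left | right].
have : ~~ good d.
  by apply: contra none => gd; apply/existsP; exists d; rewrite vd.
rewrite negb_forall => /existsP[x]; rewrite negb_forall => /existsP[y].
rewrite negb_imply => /andP[/andP[/eqP txy /eqP dxy] xy].
by rewrite (col_antisym_eq0 xy txy dxy).
Qed.

(** Relabelling the entries of a tabloid of shape la keeps its row lengths. *)
Lemma specht_content la (v : tabloid_space F n) d (i : 'I_n) :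
  v \in specht F n la -> v d != 0 -> #|[set k | d k == i]| = nth 0%N la i.
Proof.
move=> vS vd; apply: contraNeq vd => nd.
have : (specht F n la <= lker (ffun_ev F^o d))%VS.
  apply/span_subvP => _ /mapP[t tT ->]; rewrite mem_enum in tT.
  rewrite memv_ker ffun_evE sum_ffunE big1 // => s _.
  rewrite !ffunE; case: eqP => [e|_]; last by rewrite [_ *: _]mulr0.
  case/eqP: nd; rewrite -(card_tableau_row i tT) e -[RHS](card_imset _ (@perm_inj _ s)).
  congr #|pred_of_set _|; apply/setP => k; rewrite !inE !ffunE.
  apply/eqP/imsetP => [kt|[k' + ->]]; last by rewrite inE permK => /eqP.
  by exists (s^-1%g k); rewrite ?permKV // inE kt.
by move/subvP/(_ v vS); rewrite memv_ker ffun_evE.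
Qed.

Lemma sum_rows (f : 'I_n -> 'I_n) (c : nat -> nat) :
  (forall i : 'I_n, #|[set k | f k == i]| = c i) ->
  (\sum_k f k = \sum_(i < n) c i * i)%N.
Proof.
move=> fc; rewrite (partition_big f xpredT) //=; apply: eq_bigr => i _.
rewrite -fc -sum_nat_const; apply: eq_big => [k|k /eqP -> //].
by rewrite inE.
Qed.

Lemma polytabloid_specht la t : is_tableau la t -> polytabloid F t \in specht F n la.
Proof. by move=> tT; apply/memv_span/map_f; rewrite mem_enum. Qed.

(** Only [s = 1] in the column stabilizer also preserves the rows of [t]. *)
Lemma polytabloid_neq0 t : injective t -> polytabloid F t != 0.
Proof.
move=> ti; apply/eqP => /ffunP/(_ (tabloid_of t)).
rewrite sum_ffunE (bigD1 1%g) ?col_stab1 //= big1 => [|s /andP[sC s1]].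
  rewrite !ffunE permute1 eqxx odd_perm1 [_ *: _]mulr1 addr0 => /eqP.
  by rewrite oner_eq0.
rewrite !ffunE; case: eqP => [e|_]; last by rewrite [_ *: _]mulr0.
case/eqP: s1; apply/permP => k; rewrite perm1; apply: ti.
move: sC; rewrite inE => /forallP/(_ k)/eqP e2.
move/ffunP/(_ (s k)): e; rewrite !ffunE permK => e1.
by rewrite (surjective_pairing (t (s k))) e1 e2 -surjective_pairing.
Qed.

(** All tabloids occurring in [v] have the same row sum as [t], so the ones that survive
    are column permutations of [t]. *)
Lemma col_antisym_specht la t v : is_tableau la t -> v \in specht F n la ->
  exists c, col_antisym t v = c *: polytabloid F t.
Proof.
move=> tT vS.
have /fin_all_exists[c cP] : forall d, exists c,
    v d *: col_antisym t (tabloid_vec F d) = c *: polytabloid F t.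
  move=> d; case: (eqVneq (v d) 0) => [->|vd]; first by exists 0; rewrite !scale0r.
  case: (eqVneq (col_antisym t (tabloid_vec F d)) 0) => [->|nz].
    by exists 0; rewrite scaler0 scale0r.
  have [d' + dinj] := col_antisym_neq0 nz; rewrite ffunE.
  case: (eqVneq d' d) => [dd _|_]; last by rewrite eqxx.
  rewrite {}dd in dinj.
  have [_ [|s sC ->]] := tabloid_sum_ge tT dinj.
    rewrite (sum_rows (f := d) (fun i => specht_content i vS vd)).
    by rewrite (sum_rows (f := fun k => (t k).1) (fun i => card_tableau_row i tT)).
  by exists (v (permute s (tabloid_of t)) * (-1) ^+ s); rewrite col_antisym_tabloidM // scalerA.
exists (\sum_d c d); rewrite {1}(tabloid_expand v) linear_sum scaler_suml.
by apply: eq_bigr => d _; rewrite linearZ /= cP.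
Qed.

(** The statistic usually written n(la). *)
Definition weighted_size la : nat := (\sum_(i < n) nth 0%N la i * i)%N.

(** This plays the role of the dominance order: the antisymmetrizer of t only
    keeps tabloids whose row sum is at least that of t, and equality makes them
    column permutations of t, hence of the same shape. *)
Lemma col_antisym_specht_neq0 la mu t v : is_tableau la t -> v \in specht F n mu ->
  col_antisym t v != 0 ->
  (weighted_size la <= weighted_size mu)%N /\
  ((weighted_size mu <= weighted_size la)%N -> la = mu).
Proof.
move=> tT vS nz; have [d vd dinj] := col_antisym_neq0 nz.
have [le eq] := tabloid_sum_ge tT dinj; move: le eq.
rewrite (sum_rows (f := d) (fun i => specht_content i vS vd)).
rewrite (sum_rows (f := fun k => (t k).1) (fun i => card_tableau_row i tT)).
move=> le eq; split=> // /eq[s sC ds]; apply: intpart_ext => i.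
rewrite -(specht_content i vS vd) -(card_tableau_row i tT) ds.
rewrite -(card_imset [set k | (t k).1 == i] (@perm_inj _ s)).
congr #|pred_of_set _|; apply/setP => k; rewrite !inE !ffunE.
apply/imsetP/eqP => [[k' + ->]|kt]; first by rewrite inE permK => /eqP.
by exists (s^-1%g k); rewrite ?permKV // inE kt.
Qed.

Lemma tableau_permute la t t' : is_tableau la t -> is_tableau la t' ->
  exists s, t' = permute s t.
Proof.
move=> tT t'T.
have /fin_all_exists[f fP] : forall k, exists k', t k' = t' k.
  move=> k; have : t' k \in [set t x | x in 'I_n].
    by rewrite (tableau_codom tT) -(tableau_codom t'T) imset_f.
  by case/imsetP => k' _ ->; exists k'.
have finj : injective f.
  have ti : injective t' by case/andP: t'T => /injectiveP.
  by move=> x y /(congr1 t); rewrite !fP => /ti.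
by exists (perm finj)^-1%g; apply/ffunP => k; rewrite ffunE invgK permE fP.
Qed.

(** * Specht modules are simple and pairwise inequivalent *)

Definition tabloid_stable (U : {vspace tabloid_space F n}) : Prop :=
  forall s v, v \in U -> tabloid_act F s v \in U.

Lemma col_antisym_stable U t v : tabloid_stable U -> v \in U -> col_antisym t v \in U.
Proof.
by move=> US vU; rewrite col_antisymE; apply: memv_suml => s _; apply/memvZ/US.
Qed.

Lemma stable_contains_specht la t U : is_tableau la t -> tabloid_stable U ->
  polytabloid F t \in U -> (specht F n la <= U)%VS.
Proof.
move=> tT US tU; apply/span_subvP => _ /mapP[t' + ->]; rewrite mem_enum => t'T.
have [s ->] := tableau_permute tT t'T.
by rewrite -tabloid_act_polytabloid; exact: US.
Qed.

Lemma col_antisym_commute t (f : 'End(tabloid_space F n)) v :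
  (forall s w, f (tabloid_act F s w) = tabloid_act F s (f w)) ->
  f (col_antisym t v) = col_antisym t (f v).
Proof.
move=> fC; rewrite !col_antisymE linear_sum; apply: eq_bigr => s _.
by rewrite linearZ /= fC.
Qed.

(** If some antisymmetrizer of shape [la] is nonzero on [U], then [U] contains a
    polytabloid.  Otherwise, since antisymmetrizers commute with the averaged
    projection [pi] onto [U], this [pi] kills every polytabloid, hence [U]; but
    it is multiplication by n! on [U]. *)
Lemma specht_simple la U : (U <= specht F n la)%VS -> tabloid_stable U ->
  U = 0%VS \/ U = specht F n la.
Proof.
move=> UleS US.
have [[t [u [tT uU nz]]]|none] := pselect (exists t u,
    [/\ is_tableau la t, u \in U & col_antisym t u != 0]).
  right; apply/eqP; rewrite eqEsubv UleS /=.
  have [c cP] := col_antisym_specht tT (subvP UleS _ uU).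
  apply: (stable_contains_specht tT US).
  have c0 : c != 0 by apply: contraNneq nz => c0; rewrite cP c0 scale0r.
  by rewrite -[polytabloid F t](scalerK c0) -cP memvZ // col_antisym_stable.
left; pose pi : 'End(tabloid_space F n) :=
  \sum_s (tabloid_act F s \o (projv U \o tabloid_act F s^-1%g))%VF.
have piE v : pi v = \sum_s tabloid_act F s (projv U (tabloid_act F s^-1%g v)).
  by rewrite sum_lfunE; apply: eq_bigr => s _; rewrite !comp_lfunE.
have piC s v : pi (tabloid_act F s v) = tabloid_act F s (pi v).
  rewrite !piE linear_sum /= (reindex_inj (mulIg s)); apply: eq_bigr => s' _ /=.
  rewrite tabloid_actM invMg tabloid_actM -[tabloid_act F s^-1%g _]tabloid_actM.
  by rewrite mulgV tabloid_act1.
have piU v : pi v \in U.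
  by rewrite piE; apply: memv_suml => s _; apply/US/memv_proj.
have pi0 : (specht F n la <= lker pi)%VS.
  apply/span_subvP => _ /mapP[t + ->]; rewrite mem_enum memv_ker => tT.
  rewrite -col_antisym_vec col_antisym_commute //; apply: contra_notT none => nz.
  by exists t, (pi (tabloid_vec F (tabloid_of t))); split.
apply/eqP; rewrite -subv0; apply/subvP => u uU.
have := subvP pi0 _ (subvP UleS _ uU); rewrite memv_ker memv0 piE.
rewrite (eq_bigr (fun=> u)) => [|s _]; last first.
  by rewrite projv_id ?US // -tabloid_actM mulVg tabloid_act1.
by rewrite sumr_const -scaler_nat scaler_eq0 pnatr_eq0 card_Sn eqn0Ngt fact_gt0.
Qed.

End Antisymmetrizer.

Section SpechtHom.
Variables (F : numFieldType) (n : nat).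
Implicit Types (la mu : intpart n) (t : {ffun 'I_n -> 'I_n * 'I_n}).
Implicit Types (s : 'S_n) (g : hyperoct n).
Notation specht_module la := (subvs_of (specht F n la)).

(** An antihomomorphism, because permutations compose from left to right while
    signed permutations compose from right to left. *)
Definition unsigned s : hyperoct n := ([ffun=> false], s).

Lemma specht_act_simple la (U : {vspace specht_module la}) :
  (forall s w, w \in U -> specht_act F la (unsigned s) w \in U) ->
  U = 0%VS \/ U = fullv.
Proof.
move=> US; pose iota : 'Hom(specht_module la, tabloid_space F n) := linfun vsval.
have iotaE w : iota w = vsval w by rewrite lfunE.
have := @specht_simple F n la (iota @: U)%VS; case.
- by apply/subvP => _ /memv_imgP[w _ ->]; rewrite iotaE subvsP.
- move=> s _ /memv_imgP[w wU ->]; apply/memv_imgP.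
  by exists (specht_act F la (unsigned s) w); rewrite ?US // !iotaE specht_actE.
- move=> U0; left; apply/eqP; rewrite -subv0; apply/subvP => w wU.
  have : iota w \in (iota @: U)%VS by exact: memv_img.
  by rewrite U0 !memv0 iotaE => /eqP w0; apply/eqP/val_inj; rewrite /= w0.
move=> UT; right; apply/eqP; rewrite eqEsubv subvf; apply/subvP => w _.
have : vsval w \in (iota @: U)%VS by rewrite UT subvsP.
by case/memv_imgP => w' w'U; rewrite iotaE => /val_inj ->.
Qed.

Lemma specht_neq0 la : exists w : specht_module la, w != 0.
Proof.
have [t tT] := tableau_exists la; have [/injectiveP ti _] := andP tT.
exists (vsproj _ (polytabloid F t)); apply: contraNneq (polytabloid_neq0 F ti).
by move/(congr1 vsval); rewrite vsprojK ?polytabloid_specht // => ->.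
Qed.

Section Hom.
Variables (la mu : intpart n) (phi : 'Hom(specht_module la, specht_module mu)).
Hypothesis phiC : forall s w,
  phi (specht_act F la (unsigned s) w) = specht_act F mu (unsigned s) (phi w).

Lemma specht_hom_eq0 w : w != 0 -> phi w = 0 -> phi = 0.
Proof.
move=> w0 phiw; have [s v|kt|kt] := @specht_act_simple la (lker phi).
- by rewrite !memv_ker phiC => /eqP ->; rewrite linear0.
- by case/eqP: w0; apply/eqP; rewrite -memv0 -kt memv_ker phiw.
apply/lfunP => v; rewrite zero_lfunE; apply/eqP.
by rewrite -memv_ker kt memvf.
Qed.

Lemma specht_hom_polytabloid t : is_tableau la t ->
  let w := phi (vsproj _ (polytabloid F t)) in
  #|col_stab t|%:R *: vsval w = col_antisym F t (vsval w).
Proof.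
move=> tT /=; set w := vsproj _ _.
have wE : vsval w = polytabloid F t by rewrite vsprojK ?polytabloid_specht.
have -> : #|col_stab t|%:R *: vsval (phi w) = vsval (phi (#|col_stab t|%:R *: w)).
  by rewrite !linearZ.
have -> : #|col_stab t|%:R *: w =
    \sum_(s in col_stab t) (-1) ^+ s *: specht_act F la (unsigned s) w.
  apply: val_inj; rewrite /= linear_sum /= wE -col_antisym_polytabloid.
  rewrite col_antisymE; apply: eq_bigr => s _.
  by rewrite /= specht_actE wE.
rewrite col_antisymE !linear_sum; apply: eq_bigr => s _.
by rewrite !linearZ /= phiC specht_actE.
Qed.

(** A polytabloid is an eigenvector of its column antisymmetrizer with nonzero
    eigenvalue, hence so is its image. *)
Lemma specht_hom_weighted_size : phi != 0 ->
  (weighted_size la <= weighted_size mu)%N /\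
  ((weighted_size mu <= weighted_size la)%N -> la = mu).
Proof.
move=> nz; have [t tT] := tableau_exists la; have [/injectiveP ti _] := andP tT.
have eq := specht_hom_polytabloid tT.
apply: (col_antisym_specht_neq0 tT (subvsP (phi (vsproj _ (polytabloid F t))))).
rewrite -eq scaler_eq0 negb_or card_col_stab_neq0 /=.
apply: contra nz => /eqP w0; apply/eqP.
apply: (@specht_hom_eq0 (vsproj _ (polytabloid F t))); last first.
  by apply: val_inj; rewrite /= w0.
apply: contraNneq (polytabloid_neq0 F ti) => /(congr1 vsval).
by rewrite vsprojK ?polytabloid_specht // => ->.
Qed.

End Hom.

(** Maps in both directions give equality of the weighted sizes. *)
Lemma specht_mutual_hom_eq la mu (phi : 'Hom(specht_module la, specht_module mu))
    (psi : 'Hom(specht_module mu, specht_module la)) :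
  (forall s w,
    phi (specht_act F la (unsigned s) w) = specht_act F mu (unsigned s) (phi w)) ->
  (forall s w,
    psi (specht_act F mu (unsigned s) w) = specht_act F la (unsigned s) (psi w)) ->
  phi != 0 -> psi != 0 -> la = mu.
Proof.
move=> phiC psiC /(specht_hom_weighted_size phiC)[_ eq].
by case/(specht_hom_weighted_size psiC) => le _; exact: eq.
Qed.

(** The image of a polytabloid is, up to a nonzero factor, its own image under
    the column antisymmetrizer, hence a multiple of the same polytabloid; and a
    polytabloid generates the module. *)
Lemma specht_endo la (phi : 'End(specht_module la)) :
  (forall s w,
    phi (specht_act F la (unsigned s) w) = specht_act F la (unsigned s) (phi w)) ->
  exists c, forall w, phi w = c *: w.
Proof.
move=> phiC; have [t tT] := tableau_exists la; have [/injectiveP ti _] := andP tT.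
set w := vsproj (specht F n la) (polytabloid F t).
have wE : vsval w = polytabloid F t by rewrite vsprojK ?polytabloid_specht.
have [c cP] := col_antisym_specht tT (subvsP (phi w)).
have [N0 eq] := (card_col_stab_neq0 F t, specht_hom_polytabloid phiC tT).
pose b := #|col_stab t|%:R^-1 * c; exists b.
have phiw : phi w = b *: w.
  apply: val_inj; rewrite /= wE -scalerA -cP -eq scalerA mulVf // scale1r //.
have dE v : (phi - b *: \1%VF) v = phi v - b *: v.
  by rewrite add_lfunE opp_lfunE scale_lfunE id_lfunE.
have d0 : phi - b *: \1%VF = 0.
  apply: (specht_hom_eq0 _ (_ : w != 0)).
  - by move=> s v; rewrite !dE phiC linearB [in RHS]linearZ.
  - by apply: contraNneq (polytabloid_neq0 F ti) => w0; rewrite -wE w0.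
  - by rewrite dE phiw subrr.
by move=> v; apply/eqP; rewrite -subr_eq0 -dE d0 zero_lfunE.
Qed.

End SpechtHom.

(** * Cycle types *)

Section CycleType.
Variable n : nat.
Implicit Types s : 'S_n.

Lemma perm_pow_eq s x i j :
  ((s ^+ i)%g x == (s ^+ j)%g x) = (i == j %[mod #|porbit s x|]).
Proof.
set m := #|_|; have m0 : (0 < m)%N by rewrite lt0n card_porbit_neq0.
have mod_pow k : (s ^+ k)%g x = nth x (traject s x m) (k %% m).
  rewrite nth_traject ?ltn_mod // -permX {1}(divn_eq k m) expgD permM mulnC expgM.
  have fix_pow q y : (s ^+ m)%g y = y -> (s ^+ m ^+ q)%g y = y.
    by move=> e; elim: q => [|q IH]; rewrite ?expg0 ?perm1 // expgS permM e.
  by rewrite fix_pow // permX iter_porbit.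
by rewrite !mod_pow nth_uniq ?size_traject ?ltn_mod ?uniq_traject_porbit.
Qed.

Definition sorted_porbits s : seq {set 'I_n} :=
  sort (fun B B' : {set 'I_n} => (#|B'| <= #|B|)%N) (enum (porbits s)).

Lemma mem_sorted_porbits s B : (B \in sorted_porbits s) = (B \in porbits s).
Proof. by rewrite mem_sort mem_enum. Qed.

Lemma mem_porbits_eq s (B : {set 'I_n}) x : B \in porbits s -> x \in B -> porbit s x = B.
Proof. by case/imsetP => y _ ->; rewrite -eq_porbit_mem => /eqP. Qed.

Definition porbit_sizes s : seq nat := [seq #|B| | B : {set 'I_n} <- sorted_porbits s].

Lemma porbit_sizes_sorted s : sorted geq (porbit_sizes s).
Proof. by rewrite sorted_map; apply: sort_sorted => B B'; exact: leq_total. Qed.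

Lemma porbit_sizes_gt0 s : 0%N \notin porbit_sizes s.
Proof.
apply/mapP => -[B]; rewrite mem_sorted_porbits => /imsetP[x _ ->] /esym/eqP.
by rewrite (negPf (card_porbit_neq0 s x)).
Qed.

Lemma porbit_sizes_sum s : sumn (porbit_sizes s) = n.
Proof.
rewrite sumnE big_map (perm_big (enum (porbits s))) ?perm_sort // big_enum /=.
rewrite -[RHS](card_ord n) -[RHS]sum1_card (partition_big (porbit s) (mem (porbits s))) /=.
  apply: eq_bigr => B BP; rewrite -sum1_card; apply: eq_bigl => x.
  by apply/idP/eqP => [|<-]; [exact: mem_porbits_eq | exact: porbit_id].
by move=> x _; exact: imset_f.
Qed.

Definition cycle_type s : intpart n :=
  IntPart (porbit_sizes_sorted s) (porbit_sizes_gt0 s) (porbit_sizes_sum s).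

(** Matching the cycles of [s] and [s'] by rank in the sorted lists, and then
    the elements of a cycle by their distance to a base point, gives the
    conjugating permutation. *)
Lemma cycle_type_conj s s' : cycle_type s = cycle_type s' -> (s' \in s ^: [set: 'S_n])%g.
Proof.
move/(congr1 (@parts n)) => /= ct.
case: (pickP (mem 'I_n)) => [x0 _|n0]; last first.
  by have -> : s' = s; [apply/permP => x; have := n0 x | exact: class_refl].
pose h B := nth set0 (sorted_porbits s') (index B (sorted_porbits s)).
have size_eq : size (sorted_porbits s) = size (sorted_porbits s').
  by have := congr1 size ct; rewrite !size_map.
have hP B : B \in porbits s -> h B \in porbits s'.
  by rewrite -!mem_sorted_porbits => BP; rewrite mem_nth // -size_eq index_mem.
have hcard B : B \in porbits s -> #|h B| = #|B|.
  rewrite -mem_sorted_porbits => BP.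
  have Oi : (index B (sorted_porbits s) < size (sorted_porbits s))%N by rewrite index_mem.
  rewrite -(nth_map set0 0%N (fun B : {set 'I_n} => #|B|)) -?size_eq //.
  by rewrite -[X in nth _ X]/(porbit_sizes s') -ct (nth_map set0) // nth_index.
have hinj : {in porbits s &, injective h}.
  move=> B B'; rewrite -!mem_sorted_porbits => BP B'P /eqP.
  rewrite nth_uniq -?size_eq ?index_mem ?sort_uniq ?enum_uniq // => /eqP.
  by move/(congr1 (nth set0 (sorted_porbits s))); rewrite !nth_index.
pose base (B : {set 'I_n}) := odflt x0 [pick y in B].
have baseP u B : B \in porbits u -> porbit u (base B) = B.
  move=> BP; apply: mem_porbits_eq (BP) _; rewrite /base; case: pickP => //= none.
  by case/imsetP: BP none => x _ -> /(_ x); rewrite porbit_id.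
have Op u x : porbit u x \in porbits u by exact: imset_f.
have /fin_all_exists[i iP] x : exists i, x = (s ^+ i)%g (base (porbit s x)).
  by apply/porbitP; rewrite -eq_porbit_mem baseP ?Op.
pose t x := (s' ^+ i x)%g (base (h (porbit s x))).
have tP x : porbit s' (t x) = h (porbit s x) by rewrite porbit_perm baseP ?hP ?Op.
have eq_t x y j k : porbit s x = porbit s y ->
    ((s ^+ j)%g (base (porbit s x)) == (s ^+ k)%g (base (porbit s y))) =
    ((s' ^+ j)%g (base (h (porbit s x))) == (s' ^+ k)%g (base (h (porbit s y)))).
  by move=> <-; rewrite !perm_pow_eq !baseP ?hcard ?hP ?Op.
have tinj : injective t.
  move=> x y e; have Oxy : porbit s x = porbit s y.
    by apply: hinj; rewrite ?Op -?tP ?e.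
  by rewrite (iP x) (iP y); apply/eqP; rewrite eq_t //; apply/eqP.
have ts x : t (s x) = s' (t x).
  have Os : porbit s (s x) = porbit s x by have := porbit_perm s 1 x; rewrite expg1.
  apply/eqP; rewrite /t -permM -expgSr -eq_t // -iP expgSr permM -iP //.
apply/imsetP; exists (perm tinj); rewrite ?inE //; apply/permP => y.
have [x ->] : exists x, y = perm tinj x by exists ((perm tinj)^-1%g y); rewrite permKV.
by rewrite permJ !permE ts.
Qed.

End CycleType.

(** * Simple modules of the symmetric group *)

Section LinearMatrix.
Variable F : fieldType.

Definition hom_mx (V W : vectType F) (f : 'Hom(V, W)) : 'M[F]_(dim V, dim W) :=
  lin1_mx (v2r \o f \o r2v).

Lemma hom_mxE (V W : vectType F) (f : 'Hom(V, W)) v : v2r v *m hom_mx f = v2r (f v).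
Proof. by rewrite mul_rV_lin1 /= v2rK. Qed.

Lemma hom_mxM (U V W : vectType F) (f : 'Hom(U, V)) (g : 'Hom(V, W)) (h : 'Hom(U, W)) :
  (forall u, h u = g (f u)) -> hom_mx h = hom_mx f *m hom_mx g.
Proof.
move=> hE; apply/row_matrixP => i; rewrite !rowE mulmxA.
by rewrite -[delta_mx _ _]r2vK !hom_mxE hE.
Qed.

Lemma hom_mx1 (V : vectType F) (f : 'End(V)) :
  (forall v, f v = v) -> hom_mx f = 1%:M.
Proof.
move=> f1; apply/row_matrixP => i; rewrite !rowE mulmx1.
by rewrite -[delta_mx _ _]r2vK hom_mxE f1.
Qed.

End LinearMatrix.

Section Completeness.
Variables (F : numClosedFieldType) (n : nat).
Notation G := [set: 'S_n]%G.
Notation specht_module la := (subvs_of (specht F n la)).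
Implicit Types (la mu : intpart n) (s : 'S_n).

(** Permutations multiply from left to right, so a left module over signed
    permutations restricts to a right action of 'S_n, which is what matrices
    acting on row vectors provide. *)
Lemma action_mx_repr (V : vectType F) (act : 'S_n -> 'End(V)) :
  (forall v, act 1%g v = v) ->
  (forall s s' v, act (s * s')%g v = act s' (act s v)) ->
  mx_repr G (fun s => hom_mx (act s)).
Proof.
move=> act1 actM; split=> [|s s' _ _]; first exact: hom_mx1.
by apply: hom_mxM => v; rewrite actM.
Qed.

Lemma specht_unsigned1 la (w : specht_module la) : specht_act F la (unsigned 1%g) w = w.
Proof. exact: specht_act1. Qed.

Lemma specht_unsignedM la s s' (w : specht_module la) :
  specht_act F la (unsigned (s * s')%g) w =
  specht_act F la (unsigned s') (specht_act F la (unsigned s) w).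
Proof. by apply: val_inj; rewrite /= !specht_actE tabloid_actM. Qed.

Definition specht_repr la : mx_representation F G (dim (specht_module la)) :=
  MxRepresentation (action_mx_repr (@specht_unsigned1 la) (@specht_unsignedM la)).

Lemma specht_repr_irr la : mx_irreducible (specht_repr la).
Proof.
have [w w0] := specht_neq0 F la; apply/mx_irrP; split.
  rewrite lt0n; apply: contraNneq w0 => d0.
  rewrite -(inj_eq (can_inj v2rK)) linear0.
  by apply/eqP/rowP => i; have := ltn_ord i; rewrite {2}d0.
(* The row space of U is the kernel of multiplication by its cokernel. *)
move=> U modU nzU; pose f : 'Hom(specht_module la, 'rV_(dim (specht_module la))) :=
  linfun (mulmxr (cokermx U) \o v2r).
have fP v : (v \in lker f) = (v2r v <= U)%MS by rewrite memv_ker lfunE /= submxE.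
have [s v|kf|kf] := @specht_act_simple F n la (lker f).
- rewrite !fP -hom_mxE => vU; apply: submx_trans (mxmoduleP modU s _); last by rewrite inE.
  exact: submxMr.
- case/negP: nzU; rewrite -submx0; apply/row_subP => i.
  have : r2v (row i U) \in lker f by rewrite fP r2vK row_sub.
  by rewrite kf memv0 -(inj_eq (can_inj v2rK)) r2vK linear0 => /eqP ->; exact: sub0mx.
rewrite -sub1mx; apply/row_subP => i.
by rewrite -[row i _]r2vK -fP kf memvf.
Qed.

Lemma intertwiner_hom (V W : vectType F) (B : 'M[F]_(dim V, dim W)) :
  exists f : 'Hom(V, W), forall v, v2r (f v) = v2r v *m B.
Proof. by exists (linfun (r2v \o mulmxr B \o v2r)) => v; rewrite lfunE /= r2vK. Qed.

Lemma specht_rsim_hom la mu : mx_rsim (specht_repr la) (specht_repr mu) ->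
  exists2 phi : 'Hom(specht_module la, specht_module mu), phi != 0 &
    forall s w, phi (specht_act F la (unsigned s) w) = specht_act F mu (unsigned s) (phi w).
Proof.
case=> B _ freeB homB; have [phi phiE] := intertwiner_hom B; exists phi => [|s w].
  have [w w0] := specht_neq0 F la; apply: contraNneq w0 => phi0.
  rewrite -(inj_eq (can_inj v2rK)) linear0; apply/eqP/(row_free_inj freeB).
  by rewrite mul0mx -phiE phi0 zero_lfunE linear0.
apply: (can_inj v2rK); rewrite phiE -(hom_mxE (specht_act F la _)).
rewrite -(hom_mxE (specht_act F mu _)) phiE -!mulmxA; congr (_ *m _).
exact: homB.
Qed.

Lemma specht_rsim_inj la mu : mx_rsim (specht_repr la) (specht_repr mu) -> la = mu.
Proof.
move=> sim; have [phi phi0 phiC] := specht_rsim_hom sim.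
have [psi psi0 psiC] := specht_rsim_hom (mx_rsim_sym sim).
exact: specht_mutual_hom_eq phiC psiC phi0 psi0.
Qed.

Let sG := DecSocleType (regular_repr F G).
Let charG : ([pchar F]^'.-group G)%g.
Proof. by apply/pgroupP => p _ _; rewrite inE /= pchar_num. Qed.

(** The classes of [S_n] and its irreducible representations are equinumerous,
    and distinct classes yield distinct Specht modules. *)
Lemma irr_comp_specht (i : sG) : exists la, i = irr_comp sG (specht_repr la).
Proof.
pose f (C : {set 'S_n}) : sG := irr_comp sG (specht_repr (cycle_type (repr C))).
have finj : {in classes G &, injective f}.
  move=> C C' CG C'G eqf.
  have sim (D : {set 'S_n}) := rsim_irr_comp_pchar sG charG (specht_repr_irr (cycle_type (repr D))).
  have := sim C; rewrite -/(f C) eqf => simC.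
  have /specht_rsim_inj/cycle_type_conj := mx_rsim_trans simC (mx_rsim_sym (sim C')).
  have [[x _ Cx] [y _ C'y]] := (imsetP CG, imsetP C'G).
  have clr (D : {set 'S_n}) z : D = (z ^: G)%g -> D = (repr D ^: G)%g.
    move=> Dz; have : repr D \in (z ^: G)%g by rewrite Dz (mem_repr z) ?class_refl.
    by move=> /class_eqP ->.
  by move=> /class_eqP e; have := clr C x Cx; rewrite -e -(clr C' y C'y).
have : f @: classes G = setT.
  apply/eqP; rewrite eqEcard subsetT cardsT card_in_imset //.
  by rewrite (card_irr_pchar sG charG (@group_closure_closed_field F _ G)) leqnn.
move/setP/(_ i); rewrite inE => /imsetP[C _ ->]; by exists (cycle_type (repr C)).
Qed.

(** A simple submodule of [V] is equivalent to some Specht module, by comparison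
    of their components in the regular representation. *)
Lemma specht_complete (V : vectType F) (act : 'S_n -> 'End(V)) (v0 : V) :
  (forall v, act 1%g v = v) ->
  (forall s s' v, act (s * s')%g v = act s' (act s v)) -> v0 != 0 ->
  exists la, exists2 theta : 'Hom(specht_module la, V), theta != 0 &
    forall s w, theta (specht_act F la (unsigned s) w) = act s (theta w).
Proof.
move=> act1 actM nz; pose rV := MxRepresentation (action_mx_repr act1 actM).
have nz1 : (1%:M : 'M[F]_(dim V)) != 0.
  apply: contraNneq nz => e1; rewrite -(inj_eq (can_inj v2rK)) linear0.
  by rewrite -[v2r v0]mulmx1 e1 mulmx0.
have [U simU _] := dec_mxsimple_exists (mxmodule1 rV) nz1; have [modU _ _] := simU.
have irrU : mx_irreducible (submod_repr modU) by apply/submod_mx_irr.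
have [la laU] := irr_comp_specht (irr_comp sG (submod_repr modU)).
have simU' := rsim_irr_comp_pchar sG charG irrU; rewrite laU in simU'.
have simS := rsim_irr_comp_pchar sG charG (specht_repr_irr la).
have [B _ freeB homB] := mx_rsim_trans simS (mx_rsim_sym simU').
pose C : 'M_(dim (specht_module la), dim V) := val_submod B.
have vC w : v2r w *m C = val_submod (v2r w *m B) by rewrite /C val_submodE [RHS]val_submodE mulmxA.
have [theta thetaE] := intertwiner_hom C; exists la, theta => [|s w].
  have [w w0] := specht_neq0 F la; apply: contraNneq w0 => th0.
  rewrite -(inj_eq (can_inj v2rK)) linear0; apply/eqP/(row_free_inj freeB).
  apply: (@val_submod_inj _ _ U); rewrite -vC -thetaE th0 zero_lfunE linear0.
  by rewrite mul0mx linear0.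
apply: (can_inj v2rK); rewrite thetaE -(hom_mxE (specht_act F la _)) -(hom_mxE (act s)) thetaE !vC.
have := val_submodJ (rG := rV) modU (v2r w *m B) (in_setT s); rewrite /= => <-.
rewrite hom_mxE vC -hom_mxE -!mulmxA; congr (val_submod (_ *m _)).
exact: homB (in_setT s).
Qed.

End Completeness.

(** * Graded modules *)

Section Graded.
Variable F : fieldType.

Lemma grading_split (V : vectType F) (P : bool -> {vspace V}) p v : is_Z2grading P ->
  exists a b, [/\ a \in P p, b \in P (~~ p) & v = a + b].
Proof.
case=> _ PT; have : v \in (P false + P true)%VS by rewrite PT memvf.
case/memv_addP => a aP [b bP vab]; case: p; first by exists b, a; rewrite addrC.
by exists a, b.
Qed.

Lemma grading_eq0 (V : vectType F) (P : bool -> {vspace V}) p a : is_Z2grading P ->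
  a \in P p -> a \in P (~~ p) -> a = 0.
Proof.
case=> P0 _ ap anp; apply/eqP; rewrite -memv0 -P0 memv_cap.
by case: p ap anp => /= -> ->.
Qed.

Variable A : superalgebra F.
Implicit Types M N : smodule A.

Lemma sm_actDl M a b m : sm_act M (a + b) m = sm_act M a m + sm_act M b m.
Proof.
by have := sm_act_linear M 1 a b; rewrite !scale1r => ->; rewrite add_lfunE.
Qed.

Lemma sm_actZl M c a m : sm_act M (c *: a) m = c *: sm_act M a m.
Proof. by rewrite (GRing.scalable_linear (sm_act_linear M)) scale_lfunE. Qed.

Lemma sm_act_suml M (I : finType) (a : I -> A) m :
  sm_act M (\sum_i a i) m = \sum_i sm_act M (a i) m.
Proof.
apply: (big_morph (fun a => sm_act M a m)) => [b c|]; first exact: sm_actDl.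
by rewrite -(scale0r 0) sm_actZl scale0r.
Qed.

Lemma graded_submod_crit M (U : {vspace M}) :
  (forall u, u \in U -> exists a b, [/\ a \in sm_part M false, b \in sm_part M true,
     a \in U, b \in U & u = a + b]) ->
  (forall i a u, a \in sa_part A i -> u \in U -> sm_act M a u \in U) ->
  graded_submod U.
Proof.
move=> Usplit Uact; split=> [|a u uU].
  apply/eqP; rewrite eqEsubv subv_add !capvSl /= andbT; apply/subvP => u uU.
  have [a [b [aP bP aU bU ->]]] := Usplit u uU.
  by apply: memv_add; rewrite memv_cap ?aU ?bU.
have [a0 [a1 [a0P a1P ->]]] := grading_split false a (sa_grading A).
by rewrite sm_actDl memvD // (Uact _ _ _ a0P, Uact _ _ _ a1P).
Qed.

Section Schur.
Variables (M N : smodule A) (p : bool) (f : 'Hom(M, N)).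
Hypothesis fp : homog_hom p f.

Lemma homog_hom_act j a m : a \in sa_part A j ->
  sm_act N a (f m) = (-1) ^+ (p && j) *: f (sm_act M a m).
Proof.
by case: fp => _ fact aP; rewrite (fact j) // scalerA -signr_addb addbb scale1r.
Qed.

Lemma homog_hom_ker : graded_submod (lker f).
Proof.
case: fp => fpart fact; apply: graded_submod_crit => [u|i a u aP]; last first.
  by rewrite !memv_ker (fact i) // => /eqP ->; rewrite linear0 scaler0.
have [a [b [aP bP ->]]] := grading_split false u (sm_grading M).
rewrite memv_ker linearD /= addr_eq0 => /eqP fab.
have fa0 : f a = 0.
  apply: (grading_eq0 (sm_grading N) (fpart _ _ aP)).
  by rewrite fab memvN; exact: (fpart _ _ bP).
exists a, b; rewrite !memv_ker fa0 eqxx; split=> //.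
by move/esym/eqP: fab; rewrite fa0 oppr_eq0.
Qed.

Lemma homog_hom_img : graded_submod (limg f).
Proof.
case: fp => fpart fact; apply: graded_submod_crit =>
  [_ /memv_imgP[m _ ->]|i a _ aP /memv_imgP[m _ ->]].
  have [a [b [aP bP ->]]] := grading_split p m (sm_grading M).
  exists (f a), (f b); rewrite !memv_img ?memvf // linearD; split=> //.
    by have := fpart _ _ aP; rewrite addbb.
  by have := fpart _ _ bP; rewrite addNb addbb.
by rewrite (homog_hom_act _ aP) memvZ // memv_img // memvf.
Qed.

(** Schur's lemma: the kernel and the image are graded submodules. *)
Lemma homog_hom_schur : simple_smod M -> simple_smod N -> f != 0 -> bijective f.
Proof.
move=> [_ sM] [_ sN] f0; have kf : lker f == 0%VS.
  have [->//|kf] := sM _ homog_hom_ker; case/eqP: f0; apply/lfunP => m.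
  by apply/eqP; rewrite zero_lfunE -memv_ker kf memvf.
have [lf|lf] := sN _ homog_hom_img.
  case/eqP: f0; apply/lfunP => m; apply/eqP.
  by rewrite zero_lfunE -memv0 -lf memv_img // memvf.
exists (f^-1)%VF; first exact: lker0_lfunK.
by move=> y; rewrite limg_lfunVK // lf memvf.
Qed.

Lemma homog_hom_inv : bijective f -> exists2 g : 'Hom(N, M), homog_hom p g & cancel f g /\ cancel g f.
Proof.
move=> bf; have kf : lker f == 0%VS by apply/lker0P/bij_inj.
have fK := lker0_lfunK kf; have gK : cancel f^-1%VF f.
  by case: bf => g _ gK y; rewrite limg_lfunVK // -[y]gK memv_img ?memvf.
case: fp => fpart fact; exists (f^-1)%VF; split=> // [i y yP|j a y aP].
  have [a [b [aP bP yab]]] := grading_split (i (+) p) (f^-1%VF y) (sm_grading M).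
  rewrite yab; suff -> : b = 0 by rewrite addr0.
  have fb : f b = y - f a by rewrite -[y]gK yab linearD addrC addKr.
  apply: (lker0P kf); rewrite linear0; apply: (grading_eq0 (sm_grading N) (p := i)).
    by rewrite fb memvB //; have := fpart _ _ aP; rewrite addbK.
  by have := fpart _ _ bP; rewrite -addNb addbK.
by rewrite -[in LHS](gK y) (homog_hom_act _ aP) linearZ /= fK.
Qed.

End Schur.

Lemma smod_iso_sym M N : smod_iso M N -> smod_iso N M.
Proof.
case=> p [f [fp /(homog_hom_inv fp)[g gp [fK gK]]]].
by exists p, g; split=> //; exists f.
Qed.

End Graded.

(** * Sign characters *)

Section Signs.
Variables (F : numFieldType) (n : nat).
Implicit Types (e : {ffun 'I_n -> bool}) (I J : {set 'I_n}).

(** The sign change e multiplies c_I by (-1) to the power [sign_pairing e I];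
    this is the pairing of Z_2^n with its dual, indexed by subsets. *)
Definition sign_pairing e I : bool := \big[addb/false]_i (e i && (i \in I)).

Lemma sign_pairing0 I : sign_pairing [ffun=> false] I = false.
Proof. by apply: big1 => i _; rewrite ffunE. Qed.

Lemma sign_pairing_set0 e : sign_pairing e set0 = false.
Proof. by apply: big1 => i _; rewrite inE andbF. Qed.

(** The involution matches the terms of opposite signs. *)
Lemma sum_sign_eq0 (T : finType) (t : T -> T) (b : T -> bool) :
  involutive t -> (forall x, b (t x) = ~~ b x) -> \sum_x (-1) ^+ b x = 0 :> F.
Proof.
move=> tK bt; set S := \sum_x _; have : S *+ 2 == 0.
  rewrite mulr2n -{2}[S]opprK subr_eq0 {1}/S (reindex_inj (inv_inj tK)) -sumrN.
  by apply/eqP; apply: eq_bigr => x _; rewrite bt signrN.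
by rewrite -mulr_natr mulf_eq0 pnatr_eq0 orbF => /eqP.
Qed.

Lemma sum_sign_chars e : e != [ffun=> false] ->
  \sum_(I : {set 'I_n}) (-1) ^+ sign_pairing e I = 0 :> F.
Proof.
move=> e0; have [i ei] : exists i, e i.
  apply/existsP; apply: contraNT e0; rewrite negb_exists => /forallP e0.
  by apply/eqP/ffunP => i; rewrite ffunE; apply/negbTE.
apply: (sum_sign_eq0 (t := fun I => symdiff I [set i])) => [I|I].
  by rewrite -symdiffA; apply/setP => j; rewrite !in_symdiff addbb addbF.
rewrite /sign_pairing; under eq_bigr => j _ do rewrite in_symdiff andb_addr.
rewrite big_split /= [X in _ (+) X](_ : _ = true) ?addbT //.
rewrite (bigD1 i) //= ei in_set1 eqxx big1 // => j /negPf ji.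
by rewrite in_set1 ji andbF.
Qed.

Lemma sum_sign_elts I : I != set0 ->
  \sum_(e : {ffun 'I_n -> bool}) (-1) ^+ sign_pairing e I = 0 :> F.
Proof.
case/set0Pn => i iI.
apply: (sum_sign_eq0 (t := fun e : {ffun 'I_n -> bool} => [ffun j => e j (+) (j == i)])) => [e|e].
  by apply/ffunP => j; rewrite !ffunE addbK.
rewrite /sign_pairing; under eq_bigr => j _ do rewrite ffunE andb_addl.
rewrite big_split /= [X in _ (+) X](_ : _ = true) ?addbT //.
by rewrite (bigD1 i) //= iI eqxx big1 // => j /negPf ->.
Qed.

Definition sign_elt e : hyperoct n := (e, 1%g).

Lemma cliff_act_sign e I :
  cliff_act F (sign_elt e) (cbasis F I) = (-1) ^+ sign_pairing e I *: cbasis F I.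
Proof.
rewrite cliff_act_basis [in RHS]cbasis_prod.
rewrite /cmono /signed_gen /=.
rewrite (eq_bigr (fun i => (-1) ^+ e i *: cgen F i)) => [|i _]; last by rewrite perm1.
rewrite scaler_prod; congr (_ *: _).
rewrite /sign_pairing (big_morph (fun b : bool => (-1) ^+ b : F) (@signr_addb F) (erefl _)).
rewrite big_mkcond; apply: eq_bigr => i _.
by case: (i \in I); rewrite ?andbT ?andbF.
Qed.

End Signs.

(** * The Hecke-Clifford superalgebra *)

Section HeckeClifford.
Variables (F : numFieldType) (n : nat).
Notation HC := (hecke_clifford F n).
Implicit Types (e : {ffun 'I_n -> bool}) (I J : {set 'I_n}) (g h : hyperoct n).
Implicit Types (a b : clifford F n) (x y : HC) (M : smodule HC).

Definition hc_cliff a : HC := smash_elt (cliff_superaction F n) a 1%g.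
Definition hc_group g : HC := smash_elt (cliff_superaction F n) 1 g.

Lemma hc_eltE a g : smash_elt (cliff_superaction F n) a g = hc_cliff a * hc_group g :> HC.
Proof.
by rewrite [RHS]smash_eltM /= cliff_act_one mulr1 mul1g.
Qed.

Lemma hc_cliffM a b : hc_cliff (a * b) = hc_cliff a * hc_cliff b.
Proof.
by rewrite [RHS]smash_eltM /= cliff_act1 mulg1.
Qed.

Lemma hc_groupM g h : hc_group (g * h)%g = hc_group g * hc_group h.
Proof.
by rewrite [RHS]smash_eltM /= cliff_act_one mulr1.
Qed.

Lemma hc_group1 : hc_group 1%g = 1. Proof. by []. Qed.
Lemma hc_cliff1 : hc_cliff 1 = 1. Proof. by []. Qed.

Lemma hc_cliffZ c a : hc_cliff (c *: a) = c *: hc_cliff a.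
Proof. by apply/ffunP => g; rewrite !ffunE; case: ifP => // _; rewrite scaler0. Qed.

Lemma hc_group_cliff g a : hc_group g * hc_cliff a = hc_cliff (cliff_act F g a) * hc_group g.
Proof.
rewrite [LHS]smash_eltM.
rewrite [RHS]smash_eltM /=.
by rewrite cliff_act_one mul1r mulr1 mulg1 mul1g.
Qed.

Lemma hc_expand x : x = \sum_g hc_cliff (x g) * hc_group g.
Proof.
apply/ffunP => h; rewrite sum_ffunE (bigD1 h) //= -hc_eltE ffunE eqxx.
rewrite big1 ?addr0 // => g /negPf gh; rewrite -hc_eltE ffunE eq_sym gh //.
Qed.

Lemma hc_group_part g : hc_group g \in sa_part HC false.
Proof.
apply/smash_partP => h; rewrite ffunE; case: ifP => _; last exact: mem0v.
exact: cliff_part1.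
Qed.

Lemma hc_cliff_part p a : a \in cliff_part F n p -> hc_cliff a \in sa_part HC p.
Proof.
by move=> ap; apply/smash_partP => h; rewrite ffunE; case: ifP => _; rewrite ?mem0v.
Qed.

Definition cbasis_inv I : clifford F n := csign F I I *: cbasis F I.

Lemma cbasis_invM I : cbasis_inv I * cbasis F I = 1.
Proof.
rewrite -scalerAl cbasisM scalerA -expr2 /csign sqrr_sign scale1r.
by congr (cbasis F _); apply/setP => i; rewrite in_symdiff addbb inE.
Qed.

Lemma cbasis_Minv I : cbasis F I * cbasis_inv I = 1.
Proof. by rewrite -scalerAr scalerAl cbasis_invM. Qed.

(** The idempotent of the trivial character of the sign group. *)
Definition sign_idem : HC := (2 ^+ n)^-1 *: \sum_e hc_group (sign_elt e).

Lemma pow2_neq0 : 2 ^+ n != 0 :> F.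
Proof. by rewrite expf_neq0 // pnatr_eq0. Qed.

Lemma card_signs : #|{ffun 'I_n -> bool}| = (2 ^ n)%N.
Proof. by rewrite card_ffun card_bool card_ord. Qed.

(** The conjugates of [sign_idem] by the Clifford monomials are the idempotents
    of all the characters of the sign group, so they add up to 1. *)
Lemma sign_idem_resolution :
  \sum_I hc_cliff (cbasis F I) * sign_idem * hc_cliff (cbasis_inv I) = 1.
Proof.
transitivity ((2 ^+ n)^-1 *: \sum_e (\sum_I (-1) ^+ sign_pairing e I) *: hc_group (sign_elt e)).
  under [in RHS]eq_bigr => e _ do rewrite scaler_suml.
  rewrite exchange_big scaler_sumr; apply: eq_bigr => I _ /=.
  rewrite -scalerAr -scalerAl; congr (_ *: _).
  rewrite mulr_sumr mulr_suml; apply: eq_bigr => e _.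
  rewrite -mulrA hc_group_cliff linearZ /= cliff_act_sign scalerA mulrC -scalerA.
  by rewrite hc_cliffZ -scalerAl -scalerAr mulrA -hc_cliffM cbasis_Minv hc_cliff1 mul1r.
rewrite (bigD1 [ffun=> false]) //= [X in _ + X]big1 => [|e e0]; last by rewrite sum_sign_chars ?scale0r.
under eq_bigr => I _ do rewrite sign_pairing0 expr0.
rewrite sumr_const -[#|_|]cardsT -powersetT card_powerset cardsT card_ord addr0.
rewrite scalerA natrX mulVf ?pow2_neq0 // scale1r.
exact: hc_group1.
Qed.

Lemma sign_eltM e e' : (sign_elt e * sign_elt e')%g = sign_elt [ffun i => e i (+) e' i].
Proof.
by congr pair; rewrite /= ?mulg1 //; apply/ffunP => i; rewrite !ffunE /= invg1 perm1.
Qed.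

Lemma sign_idem_invar e : hc_group (sign_elt e) * sign_idem = sign_idem.
Proof.
rewrite -scalerAr; congr (_ *: _); rewrite mulr_sumr.
pose t (e' : {ffun 'I_n -> bool}) := [ffun i => e i (+) e' i] : {ffun 'I_n -> bool}.
have tK : involutive t by move=> e'; apply/ffunP => i; rewrite !ffunE addbA addbb.
rewrite [RHS](reindex_inj (inv_inj tK)); apply: eq_bigr => e' _.
by rewrite -hc_groupM sign_eltM.
Qed.

Lemma hyperoctE g : g = (sign_elt g.1 * unsigned g.2)%g.
Proof.
case: g => e s; congr pair; rewrite /= ?mulg1 //.
by apply/ffunP => i; rewrite !ffunE addbF.
Qed.

Lemma unsigned_sign s e :
  (unsigned s * sign_elt e)%g = (sign_elt [ffun i => e (s^-1%g i)] * unsigned s)%g.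
Proof.
congr pair; rewrite /= ?mulg1 ?mul1g //.
by apply/ffunP => i; rewrite !ffunE /= addbF.
Qed.

Lemma unsignedM s s' : unsigned (s * s')%g = (unsigned s' * unsigned s : hyperoct n)%g.
Proof. by congr pair; apply/ffunP => i; rewrite !ffunE. Qed.

End HeckeClifford.

(** * Clifford tensor modules *)

Section CliffordTensorModule.
Variables (F : numFieldType) (n : nat).
Notation HC := (hecke_clifford F n).
Implicit Types (e : {ffun 'I_n -> bool}) (I J : {set 'I_n}) (g h : hyperoct n).
Implicit Types (a b : clifford F n) (x y : HC) (M : smodule HC).

Definition sign_trivial (W : lrep F (hyperoct n)) : Prop :=
  forall e w, lr_act W (sign_elt e) w = w.

Section OneModule.
Variable W : lrep F (hyperoct n).
Notation K := (clifford_smodule W).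
Implicit Types (w : W) (k : ctensor W).

Lemma tensZl c a w : tens (c *: a) w = c *: tens a w.
Proof. exact: GRing.scalable_linear (tens_linearl w) c a. Qed.

Lemma tens_inj1 w : (tens (1 : clifford F n) w : ctensor W) set0 = w.
Proof. by rewrite !ffunE eqxx scale1r. Qed.

Lemma clifford_act_cliff a b w : sm_act K (hc_cliff a) (tens b w) = tens (a * b) w.
Proof. by rewrite /= ctensor_act_elt cliff_act1 lr_act1. Qed.

Lemma clifford_act_group g b w :
  sm_act K (hc_group F g) (tens b w) = tens (cliff_act F g b) (lr_act W g w).
Proof. by rewrite /= ctensor_act_elt mul1r. Qed.

(** The line of c_I carries the sign character of I, trivial only for I empty. *)
Lemma clifford_act_sign_idem k : sign_trivial W ->
  sm_act K (sign_idem F n) k = tens 1 (k set0).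
Proof.
move=> Wsign.
have idemE I w : sm_act K (sign_idem F n) (tens (cbasis F I) w) =
    (2 ^+ n)^-1 *: \sum_e (-1) ^+ sign_pairing e I *: tens (cbasis F I) w.
  rewrite sm_actZl sm_act_suml; congr (_ *: _); apply: eq_bigr => e _.
  by rewrite clifford_act_group Wsign cliff_act_sign tensZl.
rewrite [X in sm_act _ _ X](ctensor_expand k) linear_sum.
rewrite (eq_bigr _ (fun I _ => idemE I (k I))) (bigD1 set0) //= [X in _ + X]big1 => [|I I0].
  under eq_bigr => e _ do rewrite sign_pairing_set0 scale1r.
  by rewrite sumr_const card_signs -scaler_nat scalerA natrX mulVf ?pow2_neq0 // scale1r addr0.
by rewrite -scaler_suml sum_sign_elts // scale0r scaler0.
Qed.

(** With [clifford_act_sign_idem], this extracts any coordinate of a vector by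
    the action of the superalgebra. *)
Lemma clifford_act_coord I k :
  (sm_act K (hc_cliff (cbasis_inv F I)) k : ctensor W) set0 = k I.
Proof.
have invE J w : sm_act K (hc_cliff (cbasis_inv F I)) (tens (cbasis F J) w) =
  tens (cbasis_inv F I * cbasis F J) w by exact: clifford_act_cliff.
rewrite [X in sm_act _ _ X](ctensor_expand k) linear_sum.
rewrite (eq_bigr _ (fun J _ => invE J (k J))) sum_ffunE (bigD1 I) //= cbasis_invM.
rewrite tens_inj1 big1 ?addr0 // => J JI.
rewrite -scalerAl cbasisM !tensZl !ffunE.
case: eqP => [e|_]; last by rewrite scale0r !scaler0.
case/eqP: JI; apply/setP => i; move/setP/(_ i): e; rewrite in_symdiff inE.
by case: (i \in I); case: (i \in J).
Qed.

Lemma tens_unit_part w : tens 1 w \in sm_part K false.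
Proof. exact/tens_part/cliff_part1. Qed.

Definition lrep_simple : Prop :=
  (exists w : W, w != 0) /\
  forall U : {vspace W}, (forall g w, w \in U -> lr_act W g w \in U) ->
  U = 0%VS \/ U = fullv.

(** Extracting a coordinate of a nonzero vector of a submodule puts some
    nonzero 1 (x) w in it; then all of 1 (x) W, by simplicity of W, and finally
    every c_I (x) W. *)
Lemma clifford_smodule_simple : sign_trivial W -> lrep_simple -> simple_smod K.
Proof.
move=> Wsign [[w0 w0nz] Wsimple]; split=> [K0|U [_ Uact]].
  have : tens 1 w0 \in (fullv : {vspace K}) by exact: memvf.
  rewrite K0 memv0 => /eqP/ffunP/(_ set0); rewrite tens_inj1 ffunE => w00.
  by rewrite w00 eqxx in w0nz.
have [->|Unz] := eqVneq U 0%VS; [by left | right].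
pose j : 'Hom(W, ctensor W) := linfun (tens 1).
have jE w : j w = tens 1 w by rewrite /j linfun_linE //; exact: tens_linearr.
pose U0 : {vspace W} := (j @^-1: U)%VS.
have U0P w : (w \in U0) = (tens 1 w \in U) by rewrite -memv_preim jE.
have U0stable g w : w \in U0 -> lr_act W g w \in U0.
  rewrite !U0P => /(Uact (hc_group F g)).
  by rewrite clifford_act_group cliff_act_one.
have U0T : U0 = fullv.
  case: (Wsimple U0 U0stable) => // U00; case/negP: Unz.
  rewrite -subv0; apply/subvP => u uU.
  suff -> : u = (0 : ctensor W) by exact: mem0v.
  apply/ffunP => I.
  rewrite [RHS]ffunE; apply/eqP; rewrite -memv0 -U00 U0P.
  have := Uact (sign_idem F n) _ (Uact (hc_cliff (cbasis_inv F I)) _ uU).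
  by rewrite clifford_act_sign_idem // clifford_act_coord.
apply/eqP; rewrite eqEsubv subvf; apply/subvP => k _.
rewrite (ctensor_expand k); apply: memv_suml => I _.
rewrite -[cbasis F I]mulr1 -clifford_act_cliff; apply: Uact.
by rewrite -U0P U0T memvf.
Qed.

(** Frobenius reciprocity for B_n inside the superalgebra: c_I (x) w goes to
    c_I theta(w), up to the sign of a map of parity [q] passing c_I. *)
Lemma clifford_smodule_lift M q (theta : 'Hom(W, M)) :
  (forall w, theta w \in sm_part M q) ->
  (forall g w, sm_act M (hc_group F g) (theta w) = theta (lr_act W g w)) ->
  exists2 f : 'Hom(K, M), homog_hom q f & forall w, f (tens 1 w) = theta w.
Proof.
move=> thpart thact.
pose f0 (k : ctensor W) : M :=
  \sum_(I : {set 'I_n}) (-1) ^+ (q && odd #|I|) *: sm_act M (hc_cliff (cbasis F I)) (theta (k I)).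
have f0lin : linear f0.
  move=> c k k'; rewrite /f0 scaler_sumr -big_split; apply: eq_bigr => I _ /=.
  by rewrite !ffunE !linearP.
pose f : 'Hom(K, M) := linfun f0.
have fE k : f k = f0 k by rewrite /f linfun_linE.
have fbasis I w : f (tens (cbasis F I) w) =
    (-1) ^+ (q && odd #|I|) *: sm_act M (hc_cliff (cbasis F I)) (theta w).
  rewrite fE /f0 (bigD1 I) //= big1 ?addr0 => [|J /negPf JI].
    by rewrite !ffunE eqxx scale1r.
  by rewrite !ffunE JI scale0r !linear0.
have ftens p a w : a \in cliff_part F n p ->
    f (tens a w) = (-1) ^+ (q && p) *: sm_act M (hc_cliff a) (theta w).
  move=> /cliff_partP ap; rewrite {1 2}(clifford_expand a).
  have -> : hc_cliff (\sum_I a I *: cbasis F I) = \sum_I a I *: hc_cliff (cbasis F I).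
    apply/ffunP => g; rewrite ffunE sum_ffunE; under [RHS]eq_bigr => I _ do rewrite !ffunE.
    by case: ifP => // _; rewrite big1 // => I _; rewrite scaler0.
  rewrite tens_suml linear_sum sm_act_suml scaler_sumr; apply: eq_bigr => I _ /=.
  rewrite tensZl linearZ sm_actZl /= fbasis scalerA [RHS]scalerA mulrC.
  by case: (eqVneq (odd #|I|) p) => [->//|/ap ->]; rewrite !mulr0 !scale0r.
exists f => [|w]; last first.
  by rewrite (ftens false) ?cliff_part1 // andbF expr0 scale1r hc_cliff1 sm_act1.
split=> [i m /parity_spaceP mi|j x k xj].
  rewrite fE; apply: memv_suml => I _.
  case: (eqVneq (odd #|I|) i) => [<-|/mi ->]; last by rewrite !linear0 mem0v.
  by apply/memvZ/(sm_act_part _ (thpart _))/hc_cliff_part/cbasis_part.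
rewrite (ctensor_expand k) !linear_sum; apply: eq_bigr => I _ /=.
move: (k I) => w {k}; rewrite ctensor_act_tens linear_sum fbasis linearZ /=.
rewrite [X in sm_act M X](hc_expand x) sm_act_suml !scaler_sumr; apply: eq_bigr => g _.
have xg : x g \in cliff_part F n j by move: xj => /smash_partP.
have gI : cliff_act F g (cbasis F I) \in cliff_part F n (odd #|I|).
  exact/cliff_act_part/cbasis_part.
rewrite (ftens (j (+) odd #|I|)) ?cliff_partM // -thact hc_cliffM -!sm_actM.
rewrite -!mulrA hc_group_cliff andb_addr signr_addb scalerA //.
Qed.

End OneModule.

(** The idempotent of the trivial sign character is even, so it commutes with
    [f], which thus maps 1 (x) W to 1 (x) W'.  Both are even, so an odd [f]
    vanishes on 1 (x) W, which generates. *)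
Lemma clifford_hom_restrict (W W' : lrep F (hyperoct n)) p
    (f : 'Hom(clifford_smodule W, clifford_smodule W')) :
  sign_trivial W -> sign_trivial W' -> homog_hom p f ->
  exists phi : 'Hom(W, W'), [/\ p -> phi = 0,
    forall g w, phi (lr_act W g w) = lr_act W' g (phi w) &
    forall a w, f (tens a w) = tens a (phi w)].
Proof.
move=> Ws W's [fpart fact].
pose phi : 'Hom(W, W') := linfun (fun w => f (tens 1 w) set0).
have phiE w : phi w = f (tens 1 w) set0.
  by rewrite /phi linfun_linE // => c u v; rewrite tens_linearr linearP !ffunE.
have idem_part : sign_idem F n \in sa_part (hecke_clifford F n) false.
  by apply: memvZ; apply: memv_suml => e _; exact: hc_group_part.
have f1 w : f (tens 1 w) = tens 1 (phi w).
  have := fact false _ (tens 1 w) idem_part; rewrite andbF expr0 scale1r phiE.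
  by rewrite clifford_act_sign_idem // tens_inj1 clifford_act_sign_idem.
have phi0 : p -> phi = 0.
  move=> pT; apply/lfunP => w; rewrite zero_lfunE phiE.
  have := fpart _ _ (tens_unit_part w); rewrite pT => /parity_spaceP; apply.
  by rewrite cards0.
exists phi; split=> // [g w|a w].
  have := fact false (hc_group F g) (tens 1 w) (hc_group_part F g).
  rewrite f1 !clifford_act_group !cliff_act_one andbF expr0 scale1r f1.
  by move/ffunP/(_ set0); rewrite !tens_inj1.
apply: (clifford_lin_ext (V := ctensor W')
  (f := fun b => f (tens b w)) (g := fun b => tens b (phi w))).
- by move=> c b b'; rewrite tens_linearl linearP.
- exact: tens_linearl.
move=> I; rewrite -[cbasis F I]mulr1 -clifford_act_cliff.
rewrite (fact (odd #|I|)) ?hc_cliff_part ?cbasis_part // f1 clifford_act_cliff.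
case: p {fpart fact} phi0 => [/(_ isT) ->|_]; last by rewrite scale1r.
by rewrite zero_lfunE; apply/ffunP => J; rewrite !ffunE !scaler0.
Qed.

End CliffordTensorModule.

(** * The modules K^la *)

Section SpechtClifford.
Variables (F : numFieldType) (n : nat).
Implicit Types la mu : intpart n.

Lemma specht_sign_trivial la : sign_trivial (specht_lrep F n la).
Proof. by move=> e w; apply: val_inj; rewrite /= specht_actE tabloid_act1. Qed.

Lemma specht_lrep_simple la : lrep_simple (specht_lrep F n la).
Proof.
split=> [|U Ustable]; first exact: specht_neq0.
by apply: specht_act_simple => s w; exact: Ustable.
Qed.

Lemma Kmod_simple la : simple_smod (Kmod F la).
Proof.
exact: clifford_smodule_simple (@specht_sign_trivial la) (specht_lrep_simple la).
Qed.

(** An endomorphism comes from one of the Specht module, which is a scalar. *)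
Lemma Kmod_typeM la : typeM (Kmod F la).
Proof.
have [w w0] := specht_neq0 F la.
rewrite /typeM; have [sub min] := vspanP
  (fun f : 'Hom(Kmod F la, Kmod F la) => exists p, homog_hom p f).
have -> : Hom_smod (Kmod F la) (Kmod F la) = <[\1%VF]>%VS.
  apply/eqP; rewrite eqEsubv; apply/andP; split.
    apply: min => f [p fp].
    have [phi [_ phiC fE]] :=
      clifford_hom_restrict (@specht_sign_trivial la) (@specht_sign_trivial la) fp.
    have [c phic] := specht_endo (phi := phi) (fun s v => phiC (unsigned s) v).
    apply/vlineP; exists c; apply/lfunP => k; rewrite scale_lfunE id_lfunE.
    apply: (ctensor_lin_ext (f1 := f) (f2 := fun k => c *: k)) => [||a v].
    - exact: linearP.
    - by move=> d u v; rewrite scalerDr !scalerA mulrC.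
    - by rewrite fE phic; apply/ffunP => I; rewrite !ffunE !scalerA mulrC.
  rewrite -memvE; apply: sub; exists false; split=> [i m mi|j a m _].
    by rewrite addbF id_lfunE.
  by rewrite !id_lfunE scale1r.
rewrite dim_vline; case: eqP => // e.
move/lfunP/(_ (tens (W := specht_lrep F n la) 1 w)): e.
rewrite id_lfunE zero_lfunE => /ffunP/(_ set0); rewrite tens_inj1 ffunE => w00.
by rewrite w00 eqxx in w0.
Qed.

Lemma Kmod_iso_inj la mu : smod_iso (Kmod F la) (Kmod F mu) -> la = mu.
Proof.
have restrict (l m : intpart n) : smod_iso (Kmod F l) (Kmod F m) ->
    exists2 phi : 'Hom(specht_lrep F n l, specht_lrep F n m), phi != 0 &
    forall g w, phi (specht_act F l g w) = specht_act F m g (phi w).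
  case=> p [f [fp /bij_inj finj]].
  have [phi [_ phiC fE]] :=
      clifford_hom_restrict (@specht_sign_trivial l) (@specht_sign_trivial m) fp.
  exists phi => //; have [w w0] := specht_neq0 F l; apply: contraNneq w0 => phi0.
  have : f (tens (W := specht_lrep F n l) 1 w) = f 0.
    by rewrite fE phi0 zero_lfunE linear0; apply/ffunP => I; rewrite !ffunE scaler0.
  by move/finj/ffunP/(_ set0); rewrite tens_inj1 ffunE => ->.
move=> iso; have [phi phi0 phiC] := restrict _ _ iso.
have [psi psi0 psiC] := restrict _ _ (smod_iso_sym iso).
exact: (specht_mutual_hom_eq (fun s => phiC _) (fun s => psiC _) phi0 psi0).
Qed.

End SpechtClifford.

Section KmodComplete.
Variables (F : numClosedFieldType) (n : nat).
Notation HC := (hecke_clifford F n).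

(** Staying within one parity makes the extension of a map from a Specht module
    to these vectors homogeneous. *)
Definition sign_invariants (M : smodule HC) (q : bool) : {vspace M} :=
  (sm_part M q :&:
     \bigcap_(e : {ffun 'I_n -> bool}) lker (sm_act M (hc_group F (sign_elt e)) - \1%VF))%VS.

Lemma sign_invariantsP (M : smodule HC) q m :
  reflect (m \in sm_part M q /\ forall e, sm_act M (hc_group F (sign_elt e)) m = m)
    (m \in sign_invariants M q).
Proof.
rewrite memv_cap; apply: (iffP andP) => -[mq minv]; split=> //.
  move=> e; have /memv_bigcapP/(_ e isT) := minv.
  by rewrite memv_ker add_lfunE opp_lfunE id_lfunE subr_eq0 => /eqP.
apply/memv_bigcapP => e _.
by rewrite memv_ker add_lfunE opp_lfunE id_lfunE minv subrr.
Qed.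

(** By [sign_idem_resolution], a nonzero vector has a nonzero image under some
    c_I p c_I^-1, with p the idempotent of the trivial sign character. *)
Lemma sign_invariants_neq0 (M : smodule HC) :
  (fullv : {vspace M}) <> 0%VS -> exists q m, m \in sign_invariants M q /\ m != 0.
Proof.
move=> M0; have [m m0] : exists m : M, m != 0.
  by exists (vpick (fullv : {vspace M})); rewrite vpick0; apply/eqP.
have [m1 m1P] : exists m1, sm_act M (sign_idem F n) m1 != 0.
  have [I mI] : exists I, sm_act M (sign_idem F n) (sm_act M (hc_cliff (cbasis_inv F I)) m) != 0.
    apply/existsP; apply: contraNT m0; rewrite negb_exists => /forallP z.
    rewrite -[m]sm_act1 -sign_idem_resolution sm_act_suml big1 // => I _.
    by rewrite !sm_actM; have := z I; rewrite negbK => /eqP ->; rewrite linear0.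
  by exists (sm_act M (hc_cliff (cbasis_inv F I)) m).
have [q [m2 [m2q m2P]]] : exists q m2, m2 \in sm_part M q /\ sm_act M (sign_idem F n) m2 != 0.
  have [a [b [aP bP ab]]] := grading_split false m1 (sm_grading M).
  have [a0|a0] := eqVneq (sm_act M (sign_idem F n) a) 0; last by exists false, a.
  by exists true, b; split=> //; move: m1P; rewrite ab linearD /= a0 add0r.
exists q, (sm_act M (sign_idem F n) m2); split=> //; apply/sign_invariantsP; split.
  apply: (@sm_act_part _ _ M false); last exact: m2q.
  by apply: memvZ; apply: memv_suml => e _; exact: hc_group_part.
by move=> e; rewrite -sm_actM sign_idem_invar.
Qed.

(** A Specht module maps to the sign invariants of M of some parity; the
    extension of this map to K^la is a nonzero homogeneous map between simple
    modules. *)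
Lemma Kmod_complete (M : smodule HC) :
  simple_smod M -> exists la : intpart n, smod_iso M (Kmod F la).
Proof.
move=> Msimple; have [q [m [mV m0]]] := sign_invariants_neq0 Msimple.1.
set V := sign_invariants M q in mV.
have Vstable s v : v \in V -> sm_act M (hc_group F (unsigned s)) v \in V.
  move=> /sign_invariantsP[vq vinv]; apply/sign_invariantsP; split.
    exact: (@sm_act_part _ _ M false) (hc_group_part _ _) vq.
  move=> e; pose e' := [ffun i => e (s i)] : {ffun 'I_n -> bool}.
  rewrite -sm_actM -hc_groupM.
  have -> : (sign_elt e * unsigned s)%g = (unsigned s * sign_elt e')%g :> hyperoct n.
    rewrite unsigned_sign; congr (sign_elt _ * _)%g.
    by apply/ffunP => i; rewrite !ffunE permKV.
  by rewrite hc_groupM sm_actM vinv.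
pose actV s : 'End(subvs_of V) :=
  linfun (vsproj V \o sm_act M (hc_group F (unsigned s)) \o vsval).
have actVE s v : vsval (actV s v) = sm_act M (hc_group F (unsigned s)) (vsval v).
  by rewrite lfunE /= vsprojK // Vstable // subvsP.
have [|||la [theta0 th0 thC]] := @specht_complete F n
    (subvs_of V) actV (vsproj V m).
- move=> v; apply: val_inj; rewrite /= actVE.
  have -> : unsigned 1%g = 1%g :> hyperoct n by [].
  by rewrite hc_group1 sm_act1.
- by move=> s s' v; apply: val_inj; rewrite /= !actVE unsignedM hc_groupM sm_actM.
- by apply: contraNneq m0 => /(congr1 vsval); rewrite vsprojK // => ->.
pose theta : 'Hom(specht_lrep F n la, M) := linfun (vsval \o theta0).
have thetaE w : theta w = vsval (theta0 w) by rewrite lfunE.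
have thetaV w : theta w \in V by rewrite thetaE subvsP.
have thetaC g w : sm_act M (hc_group F g) (theta w) = theta (lr_act (specht_lrep F n la) g w).
  have act_perm (u : subvs_of (specht F n la)) :
      specht_act F la g u = specht_act F la (unsigned g.2) u.
    by apply: subvs_inj; rewrite !specht_actE.
  have -> : lr_act (specht_lrep F n la) g w = specht_act F la (unsigned g.2) w by exact: act_perm.
  rewrite {1}(hyperoctE g) hc_groupM sm_actM !thetaE thC actVE -thetaE.
  by have /sign_invariantsP[_ ->] := Vstable g.2 _ (thetaV w).
have thetaq w : theta w \in sm_part M q by have /sign_invariantsP[] := thetaV w.
have [f fq fE] := clifford_smodule_lift thetaq thetaC.
exists la; apply: smod_iso_sym; exists q, f; split=> //.
apply: (homog_hom_schur fq (Kmod_simple F la) Msimple).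
apply: contraNneq th0 => f0; apply/eqP/lfunP => w; apply: subvs_inj.
by rewrite -thetaE -fE f0 !zero_lfunE.
Qed.

End KmodComplete.

Theorem proposition5p4 (R : realType) (n : nat) (n_ge1 : (1 <= n)%N) :
  (forall la : intpart n,
     simple_smod (Kmod R[i] la) /\ typeM (Kmod R[i] la)) /\
  (forall la mu : intpart n,
     la <> mu -> ~ smod_iso (Kmod R[i] la) (Kmod R[i] mu)) /\
  (forall M : smodule (hecke_clifford R[i] n),
     simple_smod M -> exists la : intpart n, smod_iso M (Kmod R[i] la)).
Proof.
split=> [la|]; first by split; [exact: Kmod_simple | exact: Kmod_typeM].
split=> [la mu neq iso|M]; first exact: neq (Kmod_iso_inj iso).
exact: Kmod_complete.
Qed.
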